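(* If the network assumptions (N1)--(N4) hold and $H\ge 4dR_0$, then for all $v\in V$ and all $T\in\mathcal{T}_H$, $$H^{-1}|v-\mathcal{I}v|_{M,T}+|\mathcal{I}v|_{L,T}\le C_{d,\mu,\sigma}\,|v|_{L,U_3(T)},$$ where $C_{d,\mu,\sigma}$ is a constant depending only on $d,\mu,\sigma$.
   Context: Network. Let $d\ge 2$, $\Omega=[0,l_1]\times\cdots\times[0,l_d]$, and let $\mathcal{G}=(\mathcal{N},\mathcal{E})$ be a connected graph with finite node set $\mathcal{N}\subset\Omega$ and edge set $\mathcal{E}$ of unordered node pairs; $x\sim y$ means $\{x,y\}\in\mathcal{E}$, and $|x-y|$ is the Euclidean distance. Let $\Gamma\subset\partial\Omega$ be the Dirichlet boundary segment. For $\omega\subset\Omega$ put $\mathcal{N}(\omega)=\mathcal{N}\cap\omega$. Let $\hat V$ be the space of real functions on $\mathcal{N}$, $V=\{v\in\hat V: v(x)=0 \text{ for } x\in\mathcal{N}(\Gamma)\}$, and $(u,v)=\sum_{x\in\mathcal{N}}u(x)v(x)$. For $x\in\mathcal{N}$ let $M_x,L_x:\hat V\to\hat V$ be the symmetric linear operators with $(M_xv,v)=\frac12\sum_{y\sim x}|x-y|v(x)^2$ and $(L_xv,v)=\frac12\sum_{y\sim x}\frac{(v(x)-v(y))^2}{|x-y|}$ (so $M_x$ is diagonal). Put $M_\omega=\sum_{x\in\mathcal{N}(\omega)}M_x$, $L_\omega=\sum_{x\in\mathcal{N}(\omega)}L_x$, $|v|_{M,\omega}=(M_\omega v,v)^{1/2}$,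 $|v|_{L,\omega}=(L_\omega v,v)^{1/2}$. Network assumptions. Let $B_R(x)=[x_1-R,x_1+R)\times\cdots\times[x_d-R,x_d+R)$, where the $i$-th factor is replaced by $[x_i-R,x_i+R]$ if $x_i+R=l_i$. Boxes $B_R(x)$ below are those contained in $\Omega$; enlarged boxes $B_{R+R_0}(x)$ are understood as intersected with $\Omega$. There are a length-scale $R_0$, a uniformity constant $\sigma$ and a density $\rho$ such that: (N1, homogeneity) for all $R\ge R_0$, $x\in\Omega$: $\rho\le(2R)^{-d}|1|^2_{M,B_R(x)}\le\sigma\rho$; (N2, locality) $|x-y|<R_0$ for all $\{x,y\}\in\mathcal{E}$; (N3, boundary density) for every $y\in\Gamma$ there is $x\in\mathcal{N}(\Gamma)$ with $|x-y|<R_0$; (N4, connectivity) for all $R\ge R_0$, $x\in\Omega$ there is a connected subgraph of $\mathcal{G}$ containing all edges with one or both endpoints in $B_R(x)$ and only edges with endpoints in $B_{R+R_0}(x)$. Under these assumptions $\mu<\infty$ denotes a constant such that for all $R\ge R_0$ and $x\in\Omega$: if $B_R(x)$ contains boundary nodes (nodes of $\mathcal N(\Gamma)$), then $|v|_{M,B_R(x)}\le\mu R|v|_{L,B_{R+R_0}(x)}$ for all $v\in V$ (Friedrichs); and in all cases, for every $v\in\hat V$ there is a constant $c=c(R,x,v)$ with $|v-c|_{M,B_R(x)}\le\mu R|v|_{L,B_{R+R_0}(x)}$ (Poincaré). Such a $\mu$ exists. Mesh. $l_1,\dots,l_d$ are integer multiples of $H$, and $\mathcal{T}_H=\{B_{H/2}(x):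 x\in\Omega,\ H^{-1}x_i+1/2\in\mathbb{Z},\ i=1,\dots,d\}$ is a partition of $\Omega$ into boxes of side $H$. $\Gamma$ is a union of mesh faces. For $\omega\subset\Omega$, $U(\omega)$ is the union of all $T\in\mathcal{T}_H$ with $\overline T\cap\overline\omega\ne\emptyset$; $U_1=U$, $U_j(\omega)=U_{j-1}(U(\omega))$. Interpolation. Let $\hat{\mathcal{Q}}_H$ be the continuous functions on $\Omega$ whose restriction to each $T\in\mathcal T_H$ is a linear combination of monomials $z^{a}$, $a\in\{0,1\}^d$. Let $\phi_1,\dots,\phi_m$ be its Lagrange basis with mesh nodes $y_1,\dots,y_m$, ordered so that $\phi_1,\dots,\phi_{m_0}$ ($m_0<m$) span the functions in $\hat{\mathcal Q}_H$ vanishing on $\Gamma$. Let $\varphi_i\in\hat V$ be the restriction of $\phi_i$ to $\mathcal{N}$. Let $T_k$ be the unique element containing $y_k$, and let $\psi_k$ be the linear combination of the $\varphi_\ell$ associated with vertices of $T_k$ (regarded on $\mathcal N(T_k)$) satisfying $(M_{T_k}\psi_k,\varphi_\ell)=\delta_{k\ell}$ for $\ell=1,\dots,m$. Define $\mathcal{I}v=\sum_{k=1}^{m_0}(M_{T_k}\psi_k,v)\varphi_k$. *)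

(* Defs.v *)
From HB Require Import structures.
From mathcomp Require Import all_boot all_order all_algebra finmap.
From mathcomp Require Import all_classical all_reals all_analysis.
Import Order.TTheory GRing.Theory Num.Theory.
Import numFieldNormedType.Exports.

Set Implicit Arguments.
Unset Strict Implicit.
Unset Printing Implicit Defensive.

Local Open Scope classical_set_scope.
Local Open Scope ring_scope.

Section Geometry.
Variables (R : realType) (d : nat).
Implicit Types (l x y : 'rV[R]_d) (r H : R).

(* The library norm on row vectors is the sup norm. *)
Definition edist x y : R := Num.sqrt (\sum_i (x 0 i - y 0 i) ^+ 2).

Definition Omega l : set 'rV[R]_d := [set x | forall i, 0 <= x 0 i <= l 0 i].

Definition boundary (A : set 'rV[R]_d) : set 'rV[R]_d := closure A `\` interior A.

(* Half-open, except that an upper face lying on the upper face of Omega is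
   included.  Not intersected with Omega. *)
Definition box l r x : set 'rV[R]_d :=
  [set z | forall i, x 0 i - r <= z 0 i /\
     (if x 0 i + r == l 0 i then z 0 i <= x 0 i + r else z 0 i < x 0 i + r)].

Definition ebox l r x : set 'rV[R]_d := box l r x `&` Omega l.

Definition mesh_center l H x :=
  Omega l x /\ forall i, H^-1 * x 0 i + 2^-1 \is a Num.int.

Definition mesh l H : set (set 'rV[R]_d) :=
  [set box l (H / 2) x | x in [set x | mesh_center l H x]].

(* The closed facets of the elements, one for each center x, axis i, side b. *)
Definition mesh_face l H (F : set 'rV[R]_d) :=
  exists x (i : 'I_d) (b : bool), mesh_center l H x /\
    F = closure (box l (H / 2) x) `&`
        [set z | z 0 i = x 0 i + (-1) ^+ b * (H / 2)].

Definition union_of_mesh_faces l H (A : set 'rV[R]_d) :=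
  exists2 S : set (set 'rV[R]_d), S `<=` mesh_face l H & A = \bigcup_(F in S) F.

Definition patch l H (A : set 'rV[R]_d) : set 'rV[R]_d :=
  \bigcup_(T in [set T | mesh l H T /\ closure T `&` closure A !=set0]) T.

Definition patchn l H (j : nat) (A : set 'rV[R]_d) : set 'rV[R]_d :=
  iter j (patch l H) A.

Definition mesh_node l H : set 'rV[R]_d :=
  [set y | Omega l y /\ forall i, y 0 i / H \is a Num.int].

Definition multilinear_on (T : set 'rV[R]_d) (f : 'rV[R]_d -> R) :=
  exists c : {ffun 'I_d -> bool} -> R, forall z, T z ->
    f z = \sum_a c a * \prod_i z 0 i ^+ a i.

(* Functions on Omega are represented by total functions; only their values on
   Omega are constrained. *)
Definition Qhat l H : set ('rV[R]_d -> R) :=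
  [set f | {within Omega l, continuous f} /\
           forall T, mesh l H T -> multilinear_on T f].

(* The Lagrange basis is indexed by the mesh nodes themselves.  It is
   determined on Omega by the defining property. *)
Definition lagrange l H y : 'rV[R]_d -> R :=
  xget (fun=> 0)
    [set f | Qhat l H f /\ forall z, mesh_node l H z -> f z = (z == y)%:R].

(* The indices 1..m_0: the basis functions in the subspace of functions
   vanishing on Gamma. *)
Definition free_node l H (Gamma : set 'rV[R]_d) : set 'rV[R]_d :=
  [set y | mesh_node l H y /\ forall z, Gamma z -> lagrange l H y z = 0].

Definition element_of l H y : set 'rV[R]_d :=
  xget set0 [set T | mesh l H T /\ T y].

Definition vertex l H (T : set 'rV[R]_d) : set 'rV[R]_d :=
  mesh_node l H `&` closure T.

End Geometry.

Record network (R : realType) (d : nat) := Network {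
  node : {fset 'rV[R]_d};
  edge : rel node;
  edge_sym : symmetric edge;
  edge_irr : irreflexive edge }.
Arguments edge {R d} _ _ _.

Section Network.
Variables (R : realType) (d : nat) (G : network R d).
Notation Vhat := {ffun node G -> R}.
Implicit Types (x y : node G) (u v w : Vhat) (A Gamma : set 'rV[R]_d).

Definition elen x y : R := edist (val x) (val y).

Definition dirichlet Gamma v := forall x, Gamma (val x) -> v x = 0.

Definition ip u v : R := \sum_x u x * v x.

Definition delta x : Vhat := [ffun z => (z == x)%:R].

Definition Mop x v : Vhat :=
  (2^-1 * \sum_(y | edge G x y) elen x y) * v x *: delta x.

Definition Lop x v : Vhat :=
  2^-1 *: \sum_(y | edge G x y) ((v x - v y) / elen x y) *: (delta x - delta y).

Lemma ip_delta x v : ip (delta x) v = v x.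
Proof.
rewrite /ip (bigD1 x) //= ffunE eqxx mul1r big1 ?addr0 // => z /negbTE zx.
by rewrite ffunE zx mul0r.
Qed.

Lemma ipZ a u v : ip (a *: u) v = a * ip u v.
Proof.
by rewrite /ip mulr_sumr; apply: eq_bigr => z _; rewrite ffunE -mulrA.
Qed.

Lemma ipB u v w : ip (u - v) w = ip u w - ip v w.
Proof.
by rewrite /ip -sumrB; apply: eq_bigr => z _; rewrite !ffunE mulrBl.
Qed.

Lemma ip_sum (I : Type) (r : seq I) (P : pred I) (F : I -> Vhat) v :
  ip (\sum_(i <- r | P i) F i) v = \sum_(i <- r | P i) ip (F i) v.
Proof.
rewrite /ip exchange_big /=; apply: eq_bigr => z _.
by rewrite sum_ffunE mulr_suml.
Qed.

Lemma ip_Mop x u v :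
  ip (Mop x u) v = 2^-1 * \sum_(y | edge G x y) elen x y * (u x * v x).
Proof. by rewrite ipZ ip_delta -mulr_suml !mulrA. Qed.

Lemma ip_Lop x u v : ip (Lop x u) v =
  2^-1 * \sum_(y | edge G x y) (u x - u y) * (v x - v y) / elen x y.
Proof.
rewrite ipZ ip_sum; congr (_ * _); apply: eq_bigr => y _.
by rewrite ipZ ipB !ip_delta mulrAC.
Qed.

Lemma Mop_quad x v :
  ip (Mop x v) v = 2^-1 * \sum_(y | edge G x y) elen x y * v x ^+ 2.
Proof. exact: ip_Mop. Qed.

Lemma Lop_quad x v :
  ip (Lop x v) v = 2^-1 * \sum_(y | edge G x y) (v x - v y) ^+ 2 / elen x y.
Proof. exact: ip_Lop. Qed.

Lemma Mop_sym x u v : ip (Mop x u) v = ip (Mop x v) u.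
Proof.
by rewrite !ip_Mop; congr (_ * _); apply: eq_bigr => y _; rewrite (mulrC (u x)).
Qed.

Lemma Lop_sym x u v : ip (Lop x u) v = ip (Lop x v) u.
Proof.
by rewrite !ip_Lop; congr (_ * _); apply: eq_bigr => y _; rewrite (mulrC (u x - _)).
Qed.

Lemma Mop_linear x : linear (Mop x).
Proof.
move=> a u v; rewrite /Mop scalerA -scalerDl; congr (_ *: _).
by rewrite !ffunE /GRing.scale /= mulrDr !mulrA (mulrC _ a) !mulrA.
Qed.

Lemma Lop_linear x : linear (Lop x).
Proof.
move=> a u v; rewrite /Lop scalerA mulrC -scalerA -scalerDr; congr (_ *: _).
rewrite scaler_sumr -big_split /=; apply: eq_bigr => y _.
rewrite scalerA -scalerDl; congr (_ *: _); rewrite !ffunE /GRing.scale /=.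
by rewrite mulrA -mulrDl opprD addrACA mulrBr.
Qed.

Definition Mset A v : Vhat := \sum_(x : node G | val x \in A) Mop x v.
Definition Lset A v : Vhat := \sum_(x : node G | val x \in A) Lop x v.
Definition normM A v : R := Num.sqrt (ip (Mset A v) v).
Definition normL A v : R := Num.sqrt (ip (Lset A v) v).

Definition const_fun (c : R) : Vhat := [ffun=> c].

Definition connected_network := forall x y, connect (edge G) x y.

(* (W, e) is a connected subgraph with vertex set W and edge relation e. *)
Definition connected_subgraph (W : {set node G}) (e : rel (node G)) :=
  [/\ symmetric e, subrel e (edge G),
      forall x y, e x y -> x \in W /\ y \in W &
      {in W &, forall x y, connect e x y}].

Record network_assumptions (l : 'rV[R]_d) Gamma (R0 sigma rho : R) : Prop := {
  homogeneity : forall (r : R) (x : 'rV[R]_d),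
    R0 <= r -> Omega l x -> box l r x `<=` Omega l ->
    rho <= (2 * r) ^- d * normM (box l r x) (const_fun 1) ^+ 2 <= sigma * rho;
  locality : forall x y, edge G x y -> elen x y < R0;
  boundary_density : forall y : 'rV[R]_d, Gamma y ->
    exists2 x : node G, Gamma (val x) & edist (val x) y < R0;
  connectivity : forall (r : R) (x : 'rV[R]_d),
    R0 <= r -> Omega l x -> box l r x `<=` Omega l ->
    exists W e, [/\ connected_subgraph W e,
      forall y z, edge G y z -> box l r x (val y) \/ box l r x (val z) -> e y z &
      forall y z, e y z ->
        ebox l (r + R0) x (val y) /\ ebox l (r + R0) x (val z)] }.

Definition friedrichs (l : 'rV[R]_d) Gamma (R0 mu : R) :=
  forall (r : R) (x : 'rV[R]_d),
    R0 <= r -> Omega l x -> box l r x `<=` Omega l ->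
    (exists y : node G, Gamma (val y) /\ box l r x (val y)) ->
    forall v, dirichlet Gamma v ->
      normM (box l r x) v <= mu * r * normL (ebox l (r + R0) x) v.

Definition poincare (l : 'rV[R]_d) (R0 mu : R) :=
  forall (r : R) (x : 'rV[R]_d),
    R0 <= r -> Omega l x -> box l r x `<=` Omega l ->
    forall v, exists c : R,
      normM (box l r x) (v - const_fun c) <= mu * r * normL (ebox l (r + R0) x) v.

Definition varphi (l : 'rV[R]_d) (H : R) (y : 'rV[R]_d) : Vhat :=
  [ffun x => lagrange l H y (val x)].

(* The condition and the use of psi below involve only M_T psi with
   T = element_of l H y, hence only the values of psi at the nodes in T.  Since
   M_T is diagonal and nonnegative, M_T psi does not depend on the choice. *)
Definition psi (l : 'rV[R]_d) (H : R) (y : 'rV[R]_d) : Vhat :=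
  let T := element_of l H y in
  xget 0 [set w : Vhat |
    (exists c : 'rV[R]_d -> R,
       w = \sum_(z \in vertex l H T) c z *: varphi l H z) /\
    forall z, mesh_node l H z -> ip (Mset T w) (varphi l H z) = (z == y)%:R].

Definition interpolant (l : 'rV[R]_d) Gamma (H : R) v : Vhat :=
  \sum_(y \in free_node l H Gamma)
     ip (Mset (element_of l H y) (psi l H y)) v *: varphi l H y.

End Network.
Arguments const_fun {R d G} c.

(* Main.v *)
Require Import Defs.
From mathcomp Require Import all_boot all_order all_algebra finmap.
From mathcomp Require Import all_classical all_reals all_analysis.
From mathcomp Require Import ring lra zify.
Import Order.TTheory GRing.Theory Num.Theory.
Import numFieldNormedType.Exports.
Local Open Scope classical_set_scope.
Local Open Scope ring_scope.

(** Why the estimate holds.  The interpolation operator reproduces constants as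
    long as all the nodal functions seen by an element are free, so the error on
    an element can be computed after subtracting from [v] a constant [c] that
    approximates [v] well around the element; near the Dirichlet boundary, where
    constants are not reproduced, [v] itself is small and [c = 0] will do
    ([exists_const]).  What is left is to bound the operator in the mass seminorm
    and in the energy seminorm, with constants depending on the dimension and the
    uniformity of the network only.

    The constant.  The Poincare inequality gives one constant for each box, and
    boxes have to lie in the domain, which may be only one element wide in some
    direction, so no single box covers a patch.  The constants of two touching
    elements are compared through the box halfway between them: it overlaps each
    element in a box of half the side length, which carries a fixed fraction of
    the mass by homogeneity ([overlap_mass], [adjacent_bound]).  Four such steps
    link any two elements of the second patch ([chain_all]).

    The operator.  Multilinear functions on an element are determined by their
    values at the vertices, so the Lagrange basis consists of the tensor products
    [nodal_hat] of hat functions ([lagrangeE]); these are nonnegative, sum to one,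
    and are Lipschitz at scale [H].  The dual functions [psi] are controlled by a
    lower bound for the mass of a combination of nodal functions ([coef_bound]):
    at a vertex where the nodal value is largest in absolute value, the nodal
    function is at least [(1 - 1 / (2 * d)) ^ d > 1 / 2] on the corner box of side
    [H / (2 * d)], so it outweighs all the others there, and by the assumption
    [4 * d * R0 <= H] that corner box is large enough to carry mass.  Hence the
    Gram matrix of an element is invertible ([exists_dual]), and testing [psi]
    against itself bounds its norm ([psi_bound]).

    On the nodes of an element and their neighbours, the interpolant minus [c] is
    then a combination of nodal functions with small coefficients
    ([interpolant_error], [error_coef_bound]).  The mass estimate follows because
    the nodal functions sum to one, and the energy estimate because the energy
    density of a Lipschitz function is at most a multiple of the mass density
    ([normL_lipschitz]). *)

Set Implicit Arguments.
Unset Strict Implicit.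
Unset Printing Implicit Defensive.

(** * The weighted seminorms of the network *)

Section Seminorms.
Variables (R : realType) (d : nat) (G : network R d).
Local Notation Vhat := {ffun node G -> R}.
Local Notation one := (@const_fun R d G 1).
Implicit Types (x y : node G) (u v w : Vhat) (A B : set 'rV[R]_d) (K c : R).

(** The diagonal entry of the mass operator at [x]. *)
Definition mweight x : R := 2^-1 * \sum_(y | edge G x y) elen x y.

Lemma elen_ge0 x y : 0 <= elen x y.
Proof. exact: sqrtr_ge0. Qed.

Lemma mweight_ge0 x : 0 <= mweight x.
Proof. by rewrite mulr_ge0 ?invr_ge0 ?ler0n ?sumr_ge0// => y _; exact: elen_ge0. Qed.

Lemma ip_MsetE A u v :
  ip (Mset A u) v = \sum_(x : node G | val x \in A) mweight x * (u x * v x).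
Proof.
rewrite /Mset ip_sum; apply: eq_bigr => x _.
by rewrite ip_Mop -mulr_suml /mweight -[RHS]mulrA.
Qed.

Lemma ip_LsetE A v : ip (Lset A v) v =
  \sum_(x : node G | val x \in A)
    2^-1 * \sum_(y | edge G x y) (v x - v y) ^+ 2 / elen x y.
Proof. by rewrite /Lset ip_sum; apply: eq_bigr => x _; rewrite Lop_quad. Qed.

Lemma ip_Mset_ge0 A v : 0 <= ip (Mset A v) v.
Proof.
rewrite ip_MsetE sumr_ge0// => x _.
by rewrite mulr_ge0 ?mweight_ge0// -expr2 sqr_ge0.
Qed.

Lemma ip_Lterm_ge0 v x :
  0 <= 2^-1 * \sum_(y | edge G x y) (v x - v y) ^+ 2 / elen x y.
Proof.
rewrite mulr_ge0 ?invr_ge0 ?ler0n ?sumr_ge0// => y _.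
by rewrite divr_ge0 ?sqr_ge0// elen_ge0.
Qed.

Lemma normM_ge0 A v : 0 <= normM A v. Proof. exact: sqrtr_ge0. Qed.

Lemma normL_ge0 A v : 0 <= normL A v. Proof. exact: sqrtr_ge0. Qed.

Lemma normM_sqr A v : normM A v ^+ 2 = ip (Mset A v) v.
Proof. by rewrite /normM sqr_sqrtr// ip_Mset_ge0. Qed.

Lemma normM_sub A B v : A `<=` B -> normM A v <= normM B v.
Proof.
move=> AB; rewrite /normM ler_wsqrtr// !ip_MsetE.
rewrite big_mkcond [leRHS]big_mkcond /=; apply: ler_sum => x _.
case: ifPn => [/set_mem/AB/mem_set -> //|_]; case: ifPn => // _.
by rewrite mulr_ge0 ?mweight_ge0// -expr2 sqr_ge0.
Qed.

Lemma normL_sub A B v : A `<=` B -> normL A v <= normL B v.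
Proof.
move=> AB; rewrite /normL ler_wsqrtr// !ip_LsetE.
rewrite big_mkcond [leRHS]big_mkcond /=; apply: ler_sum => x _.
case: ifPn => [/set_mem/AB/mem_set -> //|_]; case: ifPn => // _.
exact: ip_Lterm_ge0.
Qed.

Lemma normM_le A K u v : 0 <= K ->
  (forall x, A (val x) -> `|u x| <= K * `|v x|) -> normM A u <= K * normM A v.
Proof.
move=> K0 uv; rewrite -(ler_pXn2r (n := 2)) ?nnegrE ?mulr_ge0 ?normM_ge0//.
rewrite exprMn !normM_sqr !ip_MsetE mulr_sumr ler_sum// => x /set_mem/uv h.
rewrite [leRHS]mulrCA ler_wpM2l ?mweight_ge0// -!expr2 -exprMn -[leLHS]real_normK ?num_real//.
by rewrite -[leRHS]real_normK ?num_real// normrM (ger0_norm K0) lerXn2r ?nnegrE ?mulr_ge0.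
Qed.

Lemma normM_const A c : normM A (@const_fun R d G c) = `|c| * normM A one.
Proof.
apply/eqP; rewrite -(@eqrXn2 _ 2) ?mulr_ge0 ?normM_ge0//.
rewrite exprMn !normM_sqr !ip_MsetE mulr_sumr real_normK ?num_real//.
by apply/eqP/eq_bigr => x _; rewrite !ffunE; ring.
Qed.

Lemma normM_le_const A K u : 0 <= K ->
  (forall x, A (val x) -> `|u x| <= K) -> normM A u <= K * normM A one.
Proof. by move=> K0 h; apply: normM_le => // x /h; rewrite ffunE normr1 mulr1. Qed.

Lemma normM_ge_const A K u : 0 <= K ->
  (forall x, A (val x) -> K <= `|u x|) -> K * normM A one <= normM A u.
Proof.
move=> K0 h; have := normM_const A K; rewrite (ger0_norm K0) => <-.
rewrite -[leRHS]mul1r; apply: normM_le => [|x /h]; first exact: ler01.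
by rewrite ffunE mul1r (ger0_norm K0).
Qed.

Lemma normMN A v : normM A (- v) = normM A v.
Proof.
rewrite /normM !ip_MsetE; congr Num.sqrt.
by apply: eq_bigr => x _; rewrite !ffunE mulrNN.
Qed.

(** The defect in the Cauchy-Schwarz inequality is half a double sum of squares
    (Lagrange's identity), hence nonnegative. *)
Lemma normM_CauchySchwarz A u v : `|ip (Mset A u) v| <= normM A u * normM A v.
Proof.
rewrite -(ler_pXn2r (n := 2)) ?nnegrE ?mulr_ge0 ?normM_ge0//.
rewrite real_normK ?num_real// exprMn !normM_sqr !ip_MsetE.
pose P := fun x : node G => val x \in A.
have h : 0 <= \sum_(x | P x) \sum_(y | P y)
    mweight x * mweight y * (u x * v y - u y * v x) ^+ 2.
  apply: sumr_ge0 => x _; apply: sumr_ge0 => y _.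
  by rewrite mulr_ge0 ?sqr_ge0// mulr_ge0 ?mweight_ge0.
set a := \sum_(x | P x) mweight x * (u x * u x).
set b := \sum_(x | P x) mweight x * (v x * v x).
set c := \sum_(x | P x) mweight x * (u x * v x).
suff e : \sum_(x | P x) \sum_(y | P y)
    mweight x * mweight y * (u x * v y - u y * v x) ^+ 2 = 2 * (a * b - c ^+ 2).
  by move: h; rewrite e; lra.
transitivity (\sum_(x | P x) ((mweight x * (u x * u x)) * b
   + (mweight x * (v x * v x)) * a - 2 * (mweight x * (u x * v x)) * c)).
  apply: eq_bigr => x _; rewrite /a /b /c !mulr_sumr -big_split -sumrB /=.
  by apply: eq_bigr => y _; ring.
rewrite sumrB big_split /= -!mulr_suml -mulr_sumr -/a -/b -/c; ring.
Qed.

Lemma normM_triangle A u v : normM A (u + v) <= normM A u + normM A v.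
Proof.
rewrite -(ler_pXn2r (n := 2)) ?nnegrE ?addr_ge0 ?normM_ge0//.
have e : normM A (u + v) ^+ 2 =
    normM A u ^+ 2 + 2 * ip (Mset A u) v + normM A v ^+ 2.
  rewrite !normM_sqr !ip_MsetE mulr_sumr -!big_split /=.
  by apply: eq_bigr => x _; rewrite !ffunE; ring.
have := le_trans (ler_norm _) (normM_CauchySchwarz A u v).
rewrite e; nra.
Qed.

Lemma normM_triangleB A u v : normM A (u - v) <= normM A u + normM A v.
Proof. by rewrite -[in leRHS](normMN A v) normM_triangle. Qed.

(** The energy density of a [K]-Lipschitz function along an edge is at most
    [K ^ 2] times the mass density, which is the edge length itself. *)
Lemma normL_lipschitz A K u : 0 <= K ->
  (forall x y, A (val x) -> edge G x y -> `|u x - u y| <= K * elen x y) ->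
  normL A u <= K * normM A one.
Proof.
move=> K0 uK; rewrite -(ler_pXn2r (n := 2)) ?nnegrE ?mulr_ge0 ?normM_ge0 ?normL_ge0//.
rewrite exprMn normM_sqr /normL sqr_sqrtr; last first.
  by rewrite ip_LsetE sumr_ge0// => x _; exact: ip_Lterm_ge0.
rewrite ip_LsetE ip_MsetE mulr_sumr; apply: ler_sum => x /set_mem Ax.
rewrite !ffunE !mulr1 /mweight mulrCA ler_wpM2l ?invr_ge0 ?ler0n//.
rewrite mulr_sumr; apply: ler_sum => y xy; have := uK _ _ Ax xy.
have [->|e0] := eqVneq (elen x y) 0; first by rewrite invr0 !mulr0.
have {e0} e0 : 0 < elen x y by rewrite lt_def e0 elen_ge0.
move=> h; rewrite ler_pdivrMr// -mulrA -expr2 -exprMn -[leLHS]real_normK ?num_real//.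
by rewrite lerXn2r ?nnegrE// mulr_ge0// ltW.
Qed.

Lemma ip_MsetDr A u v w : ip (Mset A u) (v + w) = ip (Mset A u) v + ip (Mset A u) w.
Proof.
by rewrite !ip_MsetE -big_split; apply: eq_bigr => x _; rewrite ffunE !mulrDr.
Qed.

Lemma ip_MsetZr A c u v : ip (Mset A u) (c *: v) = c * ip (Mset A u) v.
Proof.
rewrite !ip_MsetE mulr_sumr; apply: eq_bigr => x _.
by rewrite ffunE /GRing.scale /=; ring.
Qed.

Lemma ip_MsetC A u v : ip (Mset A u) v = ip (Mset A v) u.
Proof. by rewrite !ip_MsetE; apply: eq_bigr => x _; rewrite (mulrC (u x)). Qed.

Lemma ip_Mset_sumr A u (I : Type) (r : seq I) (P : pred I) (F : I -> Vhat) :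
  ip (Mset A u) (\sum_(i <- r | P i) F i) = \sum_(i <- r | P i) ip (Mset A u) (F i).
Proof.
rewrite ip_MsetE; under [RHS]eq_bigr do rewrite ip_MsetE.
rewrite exchange_big /=; apply: eq_bigr => x _.
by rewrite sum_ffunE !mulr_sumr.
Qed.

End Seminorms.

(** * The one-dimensional hat function *)

Section Hat.
Variable R : realType.
Implicit Types s t : R.

Definition hat t : R := Num.max 0 (1 - `|t|).

Lemma hat_ge0 t : 0 <= hat t.
Proof. by rewrite le_max lexx. Qed.

Lemma hat_le1 t : hat t <= 1.
Proof. by rewrite ge_max ler01/= lerBlDr lerDl. Qed.

Lemma hat_out t : 1 <= `|t| -> hat t = 0.
Proof. by move=> t1; apply/max_idPl; rewrite subr_le0. Qed.

Lemma hat_in t : `|t| <= 1 -> hat t = 1 - `|t|.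
Proof. by move=> t1; apply/max_idPr; rewrite subr_ge0. Qed.

Lemma hatP t : [\/ 0 <= t <= 1 /\ hat t = 1 - t, -1 <= t <= 0 /\ hat t = 1 + t
  | (1 <= t \/ t <= -1) /\ hat t = 0].
Proof.
rewrite /hat /Num.max; case: ltP; have [t0|t0] := ger0P t => h.
- by apply: Or31; split; lra.
- by apply: Or32; split; lra.
- by apply: Or33; split => //; lra.
- by apply: Or33; split => //; lra.
Qed.

Lemma hat_lipschitz s t : `|hat s - hat t| <= `|s - t|.
Proof.
have := ler_dist_dist s t; rewrite /hat /Num.max.
move: `|s| `|t| `|s - t| => a b c; rewrite !ler_norml => /andP[c1 c2].
by case: ltP => h1; case: ltP => h2; apply/andP; split; lra.
Qed.

Lemma hat_continuous : continuous hat.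
Proof.
move=> t; apply/cvgrPdist_le => e e0; near=> s.
apply: le_trans (hat_lipschitz _ _) _; near: s.
have /cvgrPdist_le := @cvg_id _ (nbhs t); exact.
Unshelve. all: by end_near. Qed.

Definition ramp t : R := Num.min 1 (Num.max 0 t).

Lemma rampP t : [\/ t <= 0 /\ ramp t = 0, 0 <= t <= 1 /\ ramp t = t
  | 1 <= t /\ ramp t = 1].
Proof.
rewrite /ramp /Num.max; case: ltP => t0.
  rewrite /Num.min; case: ltP => t1; first by apply: Or33; split => //; exact: ltW.
  by apply: Or32; split => //; apply/andP; split; [exact: ltW|].
by apply: Or31; split => //; rewrite /Num.min ltNge ler01.
Qed.

(** Writing the hat as a difference of two translates of one ramp makes sums
    over integer translates telescope. *)
Lemma hat_ramp t : hat t = ramp (1 - t) - ramp (- t).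
Proof.
by case: (hatP t) => -[? ->]; case: (rampP (1 - t)) => -[? ->];
  case: (rampP (- t)) => -[? ->]; lra.
Qed.

Lemma sum_hat_ramp N s :
  \sum_(k < N) hat (s - k%:R) = ramp (N%:R - s) - ramp (- s).
Proof.
rewrite -(big_mkord xpredT (fun k => hat (s - k%:R))).
transitivity (\sum_(0 <= k < N) (ramp (k.+1%:R - s) - ramp (k%:R - s))).
  by apply: eq_bigr => k _; rewrite hat_ramp opprB -natr1; congr (ramp _ - _); ring.
by rewrite (@telescope_sumr _ 0 N (fun k => ramp (k%:R - s)))// sub0r.
Qed.

Lemma sum_hat_le1 N s : \sum_(k < N) hat (s - k%:R) <= 1.
Proof.
rewrite sum_hat_ramp.
by case: (rampP (N%:R - s)) => -[? ->]; case: (rampP (- s)) => -[? ->]; lra.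
Qed.

Lemma sum_hat_eq1 N s : 0 <= s <= N%:R -> \sum_(k < N.+1) hat (s - k%:R) = 1.
Proof.
move=> /andP[s0 sN]; rewrite sum_hat_ramp -natr1.
by case: (rampP (N%:R + 1 - s)) => -[? ->]; case: (rampP (- s)) => -[? ->]; lra.
Qed.

(** A cheap count of the integers near [s]: three translated hats cover them. *)
Lemma count_near_le6 N s :
  \sum_(k < N) (`|k%:R - s| <= 3 / 2)%R%:R <= 6 :> R.
Proof.
have near_hat k : (`|k%:R - s| <= 3 / 2)%R%:R <=
    2 * (hat (s - 1 - k%:R) + hat (s - k%:R) + hat (s + 1 - k%:R)).
  case: ler_normlP => [[h1 h2]|_] /=; last first.
    by rewrite mulr_ge0// !addr_ge0 ?hat_ge0.
  case: (hatP (s - 1 - k%:R)) => -[? ->]; case: (hatP (s - k%:R)) => -[? ->];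
  case: (hatP (s + 1 - k%:R)) => -[? ->]; lra.
apply: (@le_trans _ _ (\sum_(k < N)
    2 * (hat (s - 1 - k%:R) + hat (s - k%:R) + hat (s + 1 - k%:R)))).
  by apply: ler_sum => k _; exact: near_hat.
rewrite -mulr_sumr !big_split /=.
have := sum_hat_le1 N (s - 1); have := sum_hat_le1 N s.
have := sum_hat_le1 N (s + 1); lra.
Qed.

(** The kinks of a hat centred at an integer are at integers. *)
Lemma hat_affine (k m : int) : exists a b : R,
  forall t, m%:~R <= t <= m%:~R + 1 -> hat (t - k%:~R) = a + b * t.
Proof.
have [km|mk] := ltP k m.
  exists 0, 0 => t /andP[h1 h2]; rewrite mul0r addr0 hat_out//.
  have : (k + 1)%:~R <= m%:~R :> R by rewrite ler_int lezD1.
  rewrite rmorphD /= => ?; rewrite ger0_norm; lra.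
have [->|km] := eqVneq k m.
  exists (1 + m%:~R), (-1) => t /andP[h1 h2].
  rewrite hat_in ger0_norm; lra.
have [->|km1] := eqVneq k (m + 1).
  exists (- m%:~R), 1 => t /andP[h1 h2]; rewrite rmorphD /=.
  rewrite hat_in ler0_norm; lra.
have : (m + 2)%:~R <= k%:~R :> R by rewrite ler_int; lia.
rewrite rmorphD /= => ?.
exists 0, 0 => t /andP[h1 h2]; rewrite mul0r addr0 hat_out//.
rewrite ler0_norm; lra.
Qed.

Lemma int_ltW1 (a b : R) : a \is a Num.int -> b \is a Num.int -> a < b -> a + 1 <= b.
Proof.
move=> /intrP[m ->] /intrP[n ->]; rewrite ltr_int => mn.
by rewrite -[1](@rmorph1 _ _ (intmul 1)) -rmorphD ler_int lezD1.
Qed.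

Lemma int_norm_leS n (a : R) : a \is a Num.int -> `|a| < n.+1%:R -> `|a| <= n%:R.
Proof.
move=> ia; have nE : n.+1%:R = n%:R + 1 :> R by rewrite natr1.
rewrite nE ltr_norml ler_norml => /andP[h1 h2].
have in1 : n%:R + 1 \is a @Num.int R by rewrite rpredD ?natr_int ?rpred1.
have iN1 : - (n%:R + 1) \is a @Num.int R by rewrite rpredN.
by have := int_ltW1 ia in1 h2; have := int_ltW1 iN1 ia h1; lra.
Qed.

Lemma int_eq (a b : R) : a \is a Num.int -> b \is a Num.int -> `|a - b| < 1 -> a = b.
Proof.
move=> ia ib; move/(@int_norm_leS 0 _ (rpredB ia ib)).
by rewrite normr_le0 subr_eq0 => /eqP.
Qed.

End Hat.

(** * Boxes and mesh elements *)

Section Boxes.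
Variables (R : realType) (d : nat) (l : 'rV[R]_d).
Implicit Types (x y z p : 'rV[R]_d) (r s H : R) (A : set 'rV[R]_d).

Definition cbox r x : set 'rV[R]_d := [set z | forall i, `|z 0 i - x 0 i| <= r].

Lemma closure_near A z e : closure A z -> 0 < e ->
  exists2 w, A w & forall i, `|w 0 i - z 0 i| < e.
Proof.
move=> /(_ (ball z e)) Az e0; have [|w [Aw zw]] := Az; first exact: nbhsx_ballx.
by exists w => // i; have := zw.2 0 i; rewrite /ball /= distrC.
Qed.

Lemma near_closure A z :
  (forall e, 0 < e -> exists2 w, A w & forall i, `|w 0 i - z 0 i| < e) ->
  closure A z.
Proof.
move=> Az B /nbhs_ballP[e e0 eB]; have [w Aw zw] := Az e e0.
exists w; split=> //; apply: eB; split => // i j.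
by rewrite ord1 /ball /= distrC.
Qed.

Lemma closure_Omega : closure (Omega l) `<=` Omega l.
Proof.
move=> z cz i; apply/andP; split; rewrite leNgt; apply/negP => h.
  have [|w /(_ i)/andP[w0 _] /(_ i)] := @closure_near _ _ (- z 0 i) cz; first lra.
  by rewrite ltr_norml; lra.
have [|w /(_ i)/andP[_ w0] /(_ i)] := @closure_near _ _ (z 0 i - l 0 i) cz; first lra.
by rewrite ltr_norml; lra.
Qed.

Lemma box_sub_cbox r x : box l r x `<=` cbox r x.
Proof.
by move=> z zx i; have [] := zx i; rewrite ler_norml; case: ifP => _ h1 h2; lra.
Qed.

Lemma box_interior r x z : (forall i, `|z 0 i - x 0 i| < r) -> box l r x z.
Proof.
by move=> h i; have := h i; rewrite ltr_norml; case: ifP => _ /andP[h1 h2]; split; lra.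
Qed.

Lemma closure_box r x : 0 < r -> closure (box l r x) = cbox r x.
Proof.
move=> r0; apply/seteqP; split => z.
  move=> cz i; rewrite leNgt; apply/negP => h.
  have [|w /box_sub_cbox/(_ i) wx /(_ i)] := closure_near (e := `|z 0 i - x 0 i| - r) cz.
    by rewrite subr_gt0.
  have := ler_distD (w 0 i) (z 0 i) (x 0 i); rewrite (distrC (z 0 i) (w 0 i)); lra.
move=> zx; apply: near_closure => e e0.
(* moving a little towards the centre gives interior points *)
pose t := Num.min 1 (e / (2 * r)).
have t0 : 0 < t by rewrite lt_min ltr01 divr_gt0// mulr_gt0.
have t1 : t <= 1 by rewrite ge_min lexx.
have te : t * r < e.
  apply: (@le_lt_trans _ _ (e / (2 * r) * r)).
    by rewrite ler_pM2r// ge_min lexx orbT.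
  have -> : e / (2 * r) * r = e / 2 by field; rewrite gt_eqF.
  lra.
exists (z + t *: (x - z)) => [|i]; last first.
  rewrite !mxE addrAC subrr add0r normrM (gtr0_norm t0) distrC.
  by apply: le_lt_trans te; rewrite ler_pM2l.
apply: box_interior => i; rewrite !mxE.
have -> : z 0 i + t * (x 0 i - z 0 i) - x 0 i = (1 - t) * (z 0 i - x 0 i) by ring.
rewrite normrM ger0_norm ?subr_ge0//.
by apply: (@le_lt_trans _ _ ((1 - t) * r)); [rewrite ler_wpM2l ?subr_ge0|nra].
Qed.

(** The upper faces agree: the smaller box is closed above exactly where it
    reaches the boundary of the domain, and there the larger one is closed. *)
Lemma box_sub r s x p :
  (forall i, x 0 i - r <= p 0 i - s /\ p 0 i + s <= x 0 i + r) ->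
  box l s p `<=` box l r x.
Proof.
move=> h z zp i; have [h1 h2] := h i; have [z1 z2] := zp i; split; first lra.
move: h2; rewrite le_eqVlt => /orP[/eqP h2|h2].
  by rewrite -h2.
by move: z2; case: ifP => _; case: ifP => _ ?; lra.
Qed.

End Boxes.

Section Mesh.
Variables (R : realType) (d : nat) (l : 'rV[R]_d) (H : R).
Hypotheses (H0 : 0 < H) (l0 : forall i, 0 < l 0 i).
Hypothesis lH : forall i, exists k : int, l 0 i = k%:~R * H.
Implicit Types (x y z : 'rV[R]_d) (A : set 'rV[R]_d).

Let H2 : 0 < H / 2. Proof. by rewrite divr_gt0. Qed.

Lemma mesh_center_int x i : mesh_center l H x ->
  exists2 a : R, a \is a Num.int & x 0 i = a * H - H / 2.
Proof.
by move=> [_ /(_ i) xi]; exists (H^-1 * x 0 i + 2^-1) => //; field; rewrite gt_eqF.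
Qed.

Lemma mesh_node_int y i : mesh_node l H y ->
  exists2 a : R, a \is a Num.int & y 0 i = a * H.
Proof. by move=> [_ /(_ i) yi]; exists (y 0 i / H) => //; rewrite divfK ?gt_eqF. Qed.

Lemma mesh_center_itv x i : mesh_center l H x -> H / 2 <= x 0 i <= l 0 i - H / 2.
Proof.
have Hp := H0.
move=> cx; have [a ia xe] := mesh_center_int i cx; have [k lk] := lH i.
have := cx.1 i; rewrite xe lk => /andP[a0 ak].
have : 0 < a by rewrite -(pmulr_lgt0 _ H0); lra.
move/(int_ltW1 (rpred0 _) ia); rewrite add0r => a1.
have : a < k%:~R + 1 by rewrite -(ltr_pM2r H0); lra.
have ik : k%:~R + 1 \is a @Num.int R by rewrite rpredD ?intr_int ?rpred1.
move/(int_ltW1 ia ik); rewrite lerD2r -(ler_pM2r H0) => a2.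
by move: a1; rewrite -(ler_pM2r H0) mul1r; lra.
Qed.

Lemma cbox_mesh_Omega x : mesh_center l H x -> cbox (H / 2) x `<=` Omega l.
Proof.
by move=> cx z zx i; have := mesh_center_itv i cx; have := zx i; rewrite ler_norml; lra.
Qed.

Lemma box_mesh_Omega x : mesh_center l H x -> box l (H / 2) x `<=` Omega l.
Proof.
by move=> cx; apply: subset_trans (cbox_mesh_Omega cx); exact: box_sub_cbox.
Qed.

Lemma mesh_cover z : Omega l z -> exists2 x, mesh_center l H x & box l (H / 2) x z.
Proof.
have Hp := H0.
move=> Oz.
(* the last element in direction i also owns its upper face *)
pose m i : R := if z 0 i == l 0 i then l 0 i / H - 1 else (Num.floor (z 0 i / H))%:~R.
have lHint i : l 0 i / H \is a Num.int.
  by have [k ->] := lH i; rewrite mulfK ?gt_eqF// intr_int.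
have mi i : m i \is a Num.int.
  by rewrite /m; case: ifP => _; rewrite ?intr_int// rpredB ?rpred1.
have mz i : m i * H <= z 0 i /\ (if z 0 i == l 0 i then z 0 i = m i * H + H
    else z 0 i < m i * H + H).
  have /andP[z0 zl] := Oz i; rewrite /m; case: eqVneq => [->|zl'].
    by rewrite mulrBl divfK ?gt_eqF//; split; lra.
  have /andP[f1 f2] := floor_itv (z 0 i / H).
  move: f1 f2; rewrite rmorphD /= ler_pdivlMr// ltr_pdivrMr// mulrDl mul1r.
  by [].
have m0 i : 0 <= m i.
  rewrite leNgt; apply/negP => h; have := int_ltW1 (mi i) (rpred0 _) h.
  rewrite -(ler_pM2r H0) mul0r mulrDl mul1r; have [_] := mz i.
  by have /andP[z0 _] := Oz i; have := l0 i; case: eqVneq => [->|_]; lra.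
have ml i : m i * H + H <= l 0 i.
  have /andP[z0 zl] := Oz i; have [h _] := mz i.
  have [e|ne] := eqVneq (z 0 i) (l 0 i).
    by have [_] := mz i; rewrite e eqxx => <-.
  have : m i < l 0 i / H by rewrite ltr_pdivlMr// (le_lt_trans h)// lt_neqAle ne.
  by move/(int_ltW1 (mi i) (lHint i)); rewrite ler_pdivlMr// mulrDl mul1r.
exists (\row_i (m i * H + H / 2)).
  split=> i; rewrite mxE.
    by have := ml i; have := m0 i; rewrite -(ler_pM2r H0) mul0r; lra.
  have -> : H^-1 * (m i * H + H / 2) + 2^-1 = m i + 1 by field; rewrite gt_eqF.
  by rewrite rpredD ?rpred1.
move=> i; rewrite mxE; have [h1 h2] := mz i; split; first lra.
have e : m i * H + H / 2 + H / 2 = m i * H + H by lra.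
rewrite e; move: h2; case: eqVneq => [zl zm|_ zm]; first by rewrite -zm zl eqxx.
by case: ifP => _; lra.
Qed.

Lemma mesh_center_near n x y i : mesh_center l H x -> mesh_center l H y ->
  `|x 0 i - y 0 i| < n.+1%:R * H -> `|x 0 i - y 0 i| <= n%:R * H.
Proof.
move=> cx cy; have [a ia ->] := mesh_center_int i cx.
have [b ib ->] := mesh_center_int i cy.
have -> : a * H - H / 2 - (b * H - H / 2) = (a - b) * H by ring.
rewrite normrM (gtr0_norm H0) ltr_pM2r// => /(int_norm_leS (rpredB ia ib)) h.
by rewrite ler_pM2r.
Qed.

(** Nodes and centres differ by half-odd multiples of [H] in each coordinate, so
    upper bounds on the difference improve by almost [H]. *)
Lemma mesh_node_near (n : nat) x y i : mesh_center l H x -> mesh_node l H y ->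
  `|y 0 i - x 0 i| < (n%:R + 3 / 2) * H -> `|y 0 i - x 0 i| <= (n%:R + 2^-1) * H.
Proof.
move=> cx ny; have [a ia ->] := mesh_center_int i cx.
have [b ib ->] := mesh_node_int i ny; rewrite ltr_norml ler_norml => /andP[h1 h2].
have in1 : (n%:R : R) \is a Num.int by exact: natr_int.
have i1 : (1 : R) \is a Num.int by exact: rpred1.
have b1 : b < a + n%:R + 1 by rewrite -(ltr_pM2r H0); lra.
have b2 : a - n%:R - 2 < b by rewrite -(ltr_pM2r H0); lra.
have := int_ltW1 ib (rpredD (rpredD ia in1) i1) b1; rewrite -(ler_pM2r H0) => h3.
have := int_ltW1 (rpredB (rpredB ia in1) (rpredD i1 i1)) ib b2.
by rewrite -(ler_pM2r H0) => h4; apply/andP; split; lra.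
Qed.

(** The closures of touching elements share the midpoint of the two centres. *)
Lemma patch_adjacent x y A : mesh_center l H x -> mesh_center l H y ->
  (forall i, `|x 0 i - y 0 i| <= H) -> box l (H / 2) x `<=` A ->
  box l (H / 2) y `<=` Defs.patch l H A.
Proof.
move=> cx cy xy xA z zy; exists (box l (H / 2) y) => //; split; first by exists y.
exists (2^-1 *: (x + y)); split.
  rewrite closure_box// => i; rewrite !mxE.
  by have := xy i; rewrite !ler_norml; lra.
apply: (closureS xA); rewrite closure_box// => i; rewrite !mxE.
by have := xy i; rewrite !ler_norml; lra.
Qed.

(** An element two steps away is reached through an intermediate one, found by
    clamping each coordinate. *)
Lemma mesh_center_clamp x y : mesh_center l H x -> mesh_center l H y ->
  (forall i, `|y 0 i - x 0 i| <= 2 * H) ->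
  exists z, [/\ mesh_center l H z, forall i, `|z 0 i - x 0 i| <= H &
    forall i, `|y 0 i - z 0 i| <= H].
Proof.
have Hp := H0.
move=> cx cy xy.
pose c i := if y 0 i > x 0 i + H then x 0 i + H
  else if y 0 i < x 0 i - H then x 0 i - H else y 0 i.
have cP i : [\/ c i = x 0 i + H /\ y 0 i > x 0 i + H,
    c i = x 0 i - H /\ y 0 i < x 0 i - H
    | c i = y 0 i /\ x 0 i - H <= y 0 i <= x 0 i + H].
  rewrite /c; case: ltP => h1; first by apply: Or31.
  by case: ltP => h2; [apply: Or32|apply: Or33; split=> //; apply/andP].
exists (\row_i c i); split=> [|i|i].
- split=> i; rewrite mxE.
    have := cx.1 i; have := cy.1 i.
    by case: (cP i) => -[-> ?]; lra.
  have := cx.2 i; have := cy.2 i.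
  case: (cP i) => -[-> _] iy ix => //.
    have -> : H^-1 * (x 0 i + H) + 2^-1 = (H^-1 * x 0 i + 2^-1) + 1.
      by field; rewrite gt_eqF.
    by rewrite rpredD ?rpred1.
  have -> : H^-1 * (x 0 i - H) + 2^-1 = (H^-1 * x 0 i + 2^-1) - 1.
    by field; rewrite gt_eqF.
  by rewrite rpredB ?rpred1.
- by rewrite mxE; case: (cP i) => -[-> ?]; rewrite ler_norml; lra.
- rewrite mxE; have := xy i; rewrite !ler_norml.
  by case: (cP i) => -[-> ?]; lra.
Qed.

End Mesh.

(** * Multilinear functions and the Lagrange basis *)

Section Multilinear.
Variables (R : realType) (d : nat).
Implicit Types (x y z : 'rV[R]_d) (T : set 'rV[R]_d) (f g : 'rV[R]_d -> R).

Definition mlin (c : {ffun 'I_d -> bool} -> R) z : R :=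
  \sum_a c a * \prod_i z 0 i ^+ a i.

Lemma prod_continuous (F : 'I_d -> 'rV[R]_d -> R) :
  (forall i, continuous (F i)) -> continuous (fun z => \prod_i F i z).
Proof.
move=> cF z; apply: (@cvg_big _ _ _ _ _ mul_continuous _ _ _ _ _ (nbhs_filter z)).
by move=> i _; exact: cF.
Qed.

Lemma mlin_continuous c : continuous (mlin c).
Proof.
move=> z; apply: (@cvg_big _ _ _ _ _ add_continuous _ _ _ _ _ (nbhs_filter z)).
move=> a _; apply: cvgM; first exact: cvg_cst.
apply: prod_continuous => i; case: (a i) => /=.
  by under eq_fun do rewrite expr1; exact: coord_continuous.
by under eq_fun do rewrite expr0; exact: cst_continuous.
Qed.

Lemma mlinB c c' z : mlin (fun a => c a - c' a) z = mlin c z - mlin c' z.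
Proof. by rewrite /mlin -sumrB; apply: eq_bigr => a _; rewrite mulrBl. Qed.

Lemma mlin_affine c z i : exists a b : R, forall t,
  mlin c (\row_j (if j == i then t else z 0 j)) = a + b * t.
Proof.
pose r (a : {ffun 'I_d -> bool}) := \prod_(j | j != i) z 0 j ^+ a j.
exists (\sum_(a : {ffun 'I_d -> bool} | ~~ a i) c a * r a).
exists (\sum_(a : {ffun 'I_d -> bool} | a i) c a * r a) => t.
rewrite /mlin (bigID (fun a : {ffun 'I_d -> bool} => a i)) /= addrC mulr_suml.
congr (_ + _); apply: eq_bigr => a ai; rewrite (bigD1 i)//= mxE eqxx.
  rewrite (negbTE ai) expr0 mul1r; congr (_ * _); apply: eq_bigr => j ji.
  by rewrite mxE (negbTE ji).
rewrite ai expr1 mulrCA [RHS]mulrC; congr (_ * (_ * _)).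
by apply: eq_bigr => j ji; rewrite mxE (negbTE ji).
Qed.

(** Along each coordinate the function is affine, so its zeros at the two ends
    propagate to the whole line: free the coordinates one after another. *)
Lemma mlin_eq0 c x (r : R) : 0 < r ->
  (forall q : 'rV[R]_d, (forall i, `|q 0 i - x 0 i| = r) -> mlin c q = 0) ->
  forall z, mlin c z = 0.
Proof.
move=> r0 vtx z.
suff P k : forall z : 'rV[R]_d, (forall i : 'I_d, (k <= i)%N -> `|z 0 i - x 0 i| = r) ->
    mlin c z = 0.
  by apply: (P d) => i; rewrite leqNgt ltn_ord.
elim: k => [|k IH] {}z zk; first by apply: vtx => i; exact: zk.
have [kd|dk] := ltnP k d; last first.
  by apply: IH => i ki; have := ltn_ord i; rewrite ltnNge (leq_trans dk ki).
pose i0 := Ordinal kd.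
have [a [b ab]] := mlin_affine c z i0.
have zero t : `|t - x 0 i0| = r -> a + b * t = 0.
  move=> tr; rewrite -ab; apply: IH => i ki; rewrite mxE.
  have [->//|ii0] := eqVneq i i0; apply: zk.
  by rewrite ltn_neqAle ki andbT eq_sym; apply: contra ii0 => /eqP e; apply/eqP/val_inj.
have : a + b * (x 0 i0 + r) = 0 by apply: zero; rewrite addrC addKr gtr0_norm.
have : a + b * (x 0 i0 - r) = 0.
  by apply: zero; rewrite addrC addKr normrN gtr0_norm.
move=> e1 e2; have /eqP : b * r = 0 by lra.
rewrite mulf_eq0 (gt_eqF r0) orbF => /eqP b0.
have a0 : a = 0 by move: e1; rewrite b0 mul0r addr0.
have -> : z = \row_j (if j == i0 then z 0 i0 else z 0 j).
  by apply/rowP => j; rewrite mxE; case: eqP => [->|].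
by rewrite ab a0 b0 mul0r addr0.
Qed.

(** An element is only half-open, so the vertices on its upper faces are reached
    by continuity. *)
Lemma within_continuous_closure (A T : set 'rV[R]_d) f g q :
  {within A, continuous f} -> continuous g -> T `<=` A ->
  (forall z, T z -> f z = g z) -> A q -> closure T q -> f q = g q.
Proof.
move=> /subspace_continuousP cf cg TA fg Aq Tq.
have FT : ProperFilter (within T (nbhs q)) by exact: within_nbhs_proper.
apply: (@cvg_unique _ (@Rhausdorff R) (f @ within T (nbhs q))).
  apply: cvg_trans (cf _ Aq); apply: cvg_app; exact: within_subset.
apply: (@cvg_trans _ (g @ within T (nbhs q))).
  apply: near_eq_cvg; rewrite near_withinE; near=> z => Tz; exact/esym/fg.
apply: cvg_trans (cg q); apply: cvg_app; exact: cvg_within.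
Unshelve. all: by end_near. Qed.

End Multilinear.

Section Lagrange.
Variables (R : realType) (d : nat) (l : 'rV[R]_d) (H : R).
Hypotheses (H0 : 0 < H) (l0 : forall i, 0 < l 0 i).
Hypothesis lH : forall i, exists k : int, l 0 i = k%:~R * H.
Implicit Types (x y z : 'rV[R]_d) (f g : 'rV[R]_d -> R).

(** The Lagrange basis function of the mesh node [y] in closed form. *)
Definition nodal_hat y z : R := \prod_i hat ((z 0 i - y 0 i) / H).

Lemma nodal_hat_ge0 y z : 0 <= nodal_hat y z.
Proof. by apply: prodr_ge0 => i _; exact: hat_ge0. Qed.

Lemma nodal_hat_supp y z : nodal_hat y z != 0 -> forall i, `|z 0 i - y 0 i| < H.
Proof.
move=> yz i; rewrite ltNge; apply: contra yz => h.
rewrite /nodal_hat (bigD1 i)//= hat_out ?mul0r// normrM normfV (gtr0_norm H0).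
by rewrite ler_pdivlMr// mul1r.
Qed.

Lemma nodal_hat_node y z : mesh_node l H y -> mesh_node l H z ->
  nodal_hat y z = (z == y)%:R.
Proof.
move=> ny nz; have [->|zy] := eqVneq z y.
  apply: big1 => i _; rewrite subrr mul0r hat_in normr0 ?subr0//; exact: ler01.
apply/eqP; apply: contraT => /nodal_hat_supp h; case/eqP: zy; apply/rowP => i.
have [a ia ea] := mesh_node_int H0 i nz; have [b ib eb] := mesh_node_int H0 i ny.
have := h i; rewrite ea eb -mulrBl normrM (gtr0_norm H0) -ltr_pdivlMr// divff ?gt_eqF//.
by move/(int_eq ia ib) ->.
Qed.

Lemma prod_dist_le (I : Type) (s : seq I) (a b : I -> R) :
  (forall i, 0 <= a i <= 1) -> (forall i, 0 <= b i <= 1) ->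
  `|\prod_(i <- s) a i - \prod_(i <- s) b i| <= \sum_(i <- s) `|a i - b i|.
Proof.
move=> a01 b01; elim: s => [|i s IH]; first by rewrite !big_nil subrr normr0.
rewrite !big_cons.
set P := \prod_(j <- s) a j; set Q := \prod_(j <- s) b j.
have -> : a i * P - b i * Q = (a i - b i) * P + b i * (P - Q) by ring.
have /andP[b0 b1] := b01 i.
have P0 : 0 <= P by apply: prodr_ge0 => j _; have /andP[] := a01 j.
have P1 : P <= 1.
  rewrite /P; elim: (s) => [|j r IHr]; first by rewrite big_nil.
  rewrite big_cons; have /andP[? ?] := a01 j.
  by rewrite mulr_ile1// prodr_ge0// => k _; have /andP[] := a01 k.
apply: (le_trans (ler_normD _ _)); rewrite !normrM (ger0_norm P0) (ger0_norm b0).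
apply: lerD; first by rewrite ler_piMr.
by apply: le_trans IH; rewrite ler_piMl.
Qed.

Lemma nodal_hat_lipschitz y z z' :
  `|nodal_hat y z - nodal_hat y z'| <= H^-1 * \sum_i `|z 0 i - z' 0 i|.
Proof.
have h01 (t : R) : 0 <= hat t <= 1 by rewrite hat_ge0 hat_le1.
apply: le_trans (prod_dist_le _ _ _) _ => //; rewrite mulr_sumr ler_sum// => i _.
apply: (le_trans (hat_lipschitz _ _)).
have -> : (z 0 i - y 0 i) / H - (z' 0 i - y 0 i) / H = (z 0 i - z' 0 i) / H by ring.
by rewrite normrM normfV (gtr0_norm H0) mulrC.
Qed.

Lemma nodal_hat_continuous y : continuous (nodal_hat y).
Proof.
apply: prod_continuous => i z.
apply: (@continuous_comp _ _ _ (fun z : 'rV[R]_d => (z 0 i - y 0 i) / H) (@hat R)); last first.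
  exact: hat_continuous.
apply: continuousM; last exact: cst_continuous.
by apply: continuousB; [exact: coord_continuous|exact: cst_continuous].
Qed.

(** On an element each factor is affine in its own coordinate; expanding the
    product over the subsets of the coordinates gives the monomials. *)
Lemma nodal_hat_multilinear x y : mesh_center l H x -> mesh_node l H y ->
  multilinear_on (cbox (H / 2) x) (nodal_hat y).
Proof.
move=> cx ny; have Hp := H0.
have aff i : exists p : R * R, forall z, cbox (H / 2) x z ->
    hat ((z 0 i - y 0 i) / H) = p.1 + p.2 * z 0 i.
  have [_ /intrP[m ->] ex] := mesh_center_int H0 i cx.
  have [_ /intrP[k ->] ey] := mesh_node_int H0 i ny.
  have [a [b ab]] := hat_affine R k (m - 1).
  exists (a, b / H) => z /(_ i) zx /=.
  have -> : (z 0 i - y 0 i) / H = z 0 i / H - k%:~R.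
    by rewrite ey mulrBl mulfK ?gt_eqF.
  rewrite ab; first by rewrite mulrAC mulrA.
  move: zx; rewrite ex ler_norml rmorphB /= => /andP[z1 z2].
  by rewrite ler_pdivlMr// ler_pdivrMr// !mulrDl mulNr; apply/andP; split; lra.
have /choice[p pP] := aff.
exists (fun a : {ffun 'I_d -> bool} => \prod_i if a i then (p i).2 else (p i).1).
move=> z zx; transitivity (\prod_i \sum_(b : bool)
    (if b then (p i).2 else (p i).1) * z 0 i ^+ b).
  by apply: eq_bigr => i _; rewrite pP// big_bool /= expr0 expr1 mulr1 addrC.
rewrite bigA_distr_bigA /=; apply: eq_bigr => a _.
by rewrite big_split.
Qed.

Lemma nodal_hat_Qhat y : mesh_node l H y -> Qhat l H (nodal_hat y).
Proof.
move=> ny; split; first exact/continuous_subspaceT/nodal_hat_continuous.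
move=> _ [x cx <-]; have [c h] := nodal_hat_multilinear cx ny.
by exists c => z /box_sub_cbox; exact: h.
Qed.

(** The interpolation property is unisolvent: on each element the two functions
    are multilinear and agree at the vertices. *)
Lemma Qhat_eq f g : Qhat l H f -> Qhat l H g ->
  (forall z, mesh_node l H z -> f z = g z) -> forall z, Omega l z -> f z = g z.
Proof.
move=> [cf mf] [cg mg] fg z Oz; have H2 : 0 < H / 2 by rewrite divr_gt0.
have [x cx xz] := mesh_cover H0 l0 lH Oz.
have mx : mesh l H (box l (H / 2) x) by exists x.
have [c fc] := mf _ mx; have [c' gc] := mg _ mx.
have TO := box_mesh_Omega H0 lH cx.
suff e : mlin (fun a => c a - c' a) z = 0.
  by apply/eqP; rewrite -subr_eq0 fc// gc// -/(mlin c z) -/(mlin c' z) -mlinB e.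
apply: (mlin_eq0 (x := x) H2) => q qx.
have Cq : cbox (H / 2) x q by move=> i; rewrite qx.
have Oq := cbox_mesh_Omega H0 lH cx Cq.
have clq : closure (box l (H / 2) x) q by rewrite closure_box.
have nq : mesh_node l H q.
  split=> // i; have [a ia ea] := mesh_center_int H0 i cx.
  have := qx i; rewrite ea; have [h|h] := ger0P (q 0 i - (a * H - H / 2)) => e.
    have -> : q 0 i = a * H by lra.
    by rewrite mulfK ?gt_eqF.
  have -> : q 0 i = (a - 1) * H by lra.
  by rewrite mulfK ?gt_eqF// rpredB ?rpred1.
rewrite mlinB; apply/eqP; rewrite subr_eq0; apply/eqP.
rewrite -(within_continuous_closure cf (@mlin_continuous _ _ c) TO fc Oq clq).
by rewrite -(within_continuous_closure cg (@mlin_continuous _ _ c') TO gc Oq clq) fg.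
Qed.

Lemma lagrangeE y z : mesh_node l H y -> Omega l z ->
  Defs.lagrange l H y z = nodal_hat y z.
Proof.
move=> ny; pose P := [set f | Qhat l H f /\ forall z, mesh_node l H z -> f z = (z == y)%:R].
have [Ql ly] : P (Defs.lagrange l H y).
  apply: xgetPex; exists (nodal_hat y); split; first exact: nodal_hat_Qhat.
  by move=> {}z nz; exact: nodal_hat_node.
apply: (Qhat_eq Ql (nodal_hat_Qhat ny)) => {}z nz.
by rewrite ly// nodal_hat_node.
Qed.

End Lagrange.

(** * Sums over the mesh nodes *)

Section Lattice.
Variables (R : realType) (d : nat) (l : 'rV[R]_d) (H : R) (N : nat).
Hypotheses (H0 : 0 < H) (lN : forall i, l 0 i <= N%:R * H).
Hypothesis lH : forall i, exists k : int, l 0 i = k%:~R * H.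
Implicit Types (x y z t : 'rV[R]_d) (a b : {ffun 'I_d -> 'I_N.+1}).

(** The mesh nodes are indexed by a fixed finite type, so that sums of products
    over them factor; the type also contains points beyond the domain. *)
Definition lattice_pt a : 'rV[R]_d := \row_i ((a i)%:R * H).

Lemma lattice_pt_inj : injective lattice_pt.
Proof.
move=> a b /rowP ab; apply/ffunP => i; apply/val_inj; have := ab i.
rewrite !mxE => /(mulIf (lt0r_neq0 H0)) /eqP.
by rewrite eqr_nat => /eqP.
Qed.

Lemma mesh_node_lattice y : mesh_node l H y -> exists a, y = lattice_pt a.
Proof.
move=> ny; have /choice[f fP] i : exists k : 'I_N.+1, y 0 i = k%:R * H.
  have [_ /intrP[m ->] ey] := mesh_node_int H0 i ny.
  have /andP[] := ny.1 i; rewrite ey pmulr_lge0// ler0z => m0 ml.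
  have : m%:~R * H <= N%:R * H by exact: le_trans ml (lN i).
  rewrite ler_pM2r// -[N%:R]/(N%:Z%:~R) ler_int => mN.
  have mN' : (`|m| < N.+1)%N by lia.
  exists (Ordinal mN') => /=; congr (_ * _).
  by rewrite -{1}(gez0_abs m0).
by exists [ffun i => f i]; apply/rowP => i; rewrite mxE ffunE fP.
Qed.

Lemma lattice_mesh_node a : Omega l (lattice_pt a) -> mesh_node l H (lattice_pt a).
Proof. by move=> Oa; split=> // i; rewrite mxE mulfK ?gt_eqF// natr_int. Qed.

Lemma fsum_lattice (V : nmodType) (A : set 'rV[R]_d) (F : 'rV[R]_d -> V) :
  A `<=` mesh_node l H ->
  \sum_(y \in A) F y = \sum_(a | lattice_pt a \in A) F (lattice_pt a).
Proof.
move=> An; pose s := [seq lattice_pt a | a <- enum [pred a | lattice_pt a \in A]].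
have sA y : (y \in s) = (y \in A).
  apply/mapP/idP => [[a]|yA]; first by rewrite mem_enum => h ->.
  have [a ya] := mesh_node_lattice (An _ (set_mem yA)).
  by exists a => //; rewrite mem_enum /= unfold_in /= -ya.
rewrite (@fsbigE _ _ _ _ _ s) => [|||y Ay].
- rewrite /s big_map big_enum_cond /=; apply: eq_bigl => a.
  by rewrite unfold_in /= andbb.
- by rewrite map_inj_uniq ?enum_uniq//; exact: lattice_pt_inj.
- by move=> y /=; rewrite sA => /set_mem.
- by rewrite sA (mem_set Ay).
Qed.

(** Lattice points beyond the upper faces of the domain are too far to matter. *)
Lemma nodal_hat_mesh_node a z : Omega l z -> nodal_hat H (lattice_pt a) z != 0 ->
  mesh_node l H (lattice_pt a).
Proof.
move=> Oz az; apply: lattice_mesh_node => i; have Hp := H0.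
have := nodal_hat_supp H0 az i; rewrite ltr_norml mxE => /andP[h1 h2].
rewrite mulr_ge0 ?ler0n ?(ltW H0)//=; have [k lk] := lH i.
have /andP[_] := Oz i; rewrite lk => zl.
have : (a i)%:R * H < (k + 1)%:~R * H by rewrite rmorphD /= mulrDl mul1r; lra.
rewrite ltr_pM2r// -[(a i)%:R]/((Posz (a i))%:~R) ltr_int ltzD1.
by rewrite -(ler_int R) ler_pM2r.
Qed.

(** Expanding the product of the one-dimensional partitions of unity. *)
Lemma sum_nodal_hat z : Omega l z -> \sum_a nodal_hat H (lattice_pt a) z = 1.
Proof.
move=> Oz; transitivity (\prod_(i < d) \sum_(k < N.+1) hat (z 0 i / H - k%:R)).
  rewrite bigA_distr_bigA /=; apply: eq_bigr => a _; apply: eq_bigr => i _.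
  by rewrite mxE mulrBl mulfK ?gt_eqF.
apply: big1 => i _; apply: sum_hat_eq1; have /andP[z0 zl] := Oz i.
by rewrite divr_ge0 ?(ltW H0)//= ler_pdivrMr// (le_trans zl).
Qed.

Lemma count_lattice_near t :
  \sum_a [forall i, `|lattice_pt a 0 i - t 0 i| <= 3 / 2 * H]%:R <= 6 ^+ d :> R.
Proof.
pose F i (k : 'I_N.+1) : R := (`|k%:R - t 0 i / H| <= 3 / 2)%R%:R.
apply: (@le_trans _ _ (\prod_i \sum_k F i k)); last first.
  apply: (@le_trans _ _ (\prod_(i < d) 6)); last by rewrite prodr_const card_ord.
  apply: ler_prod => i _; rewrite count_near_le6 andbT.
  by apply: sumr_ge0 => k _; exact: ler0n.
rewrite bigA_distr_bigA; apply: ler_sum => a _.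
case: forallP => [h|_]; last by apply: prodr_ge0 => i _; exact: ler0n.
rewrite /F big1// => i _; have := h i; rewrite mxE.
have -> : (a i)%:R * H - t 0 i = ((a i)%:R - t 0 i / H) * H.
  by field; rewrite gt_eqF.
by rewrite normrM (gtr0_norm H0) ler_pM2r// => ->.
Qed.

End Lattice.

(** A square system that is injective is solvable: for an invertible Gram matrix
    this yields the elements of the dual family. *)
Lemma gram_solve (F : fieldType) (I : finType) (P : pred I) (g : I -> I -> F) :
  (forall c : I -> F, (forall j, P j -> \sum_(i | P i) c i * g i j = 0) ->
     forall i, P i -> c i = 0) ->
  forall k, exists c : I -> F,
    forall j, P j -> \sum_(i | P i) c i * g i j = (j == k)%:R.
Proof.
move=> inj k; have [i0 Pi0|P0] := pickP P; last first.
  by exists (fun=> 0) => j; rewrite P0.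
pose A : 'M[F]_#|P| := \matrix_(i, j) g (enum_val i) (enum_val j).
pose ext (u : 'rV[F]_#|P|) i := u 0 (enum_rank_in Pi0 i).
have extE (u : 'rV[F]_#|P|) j : P j ->
    \sum_(i | P i) ext u i * g i j = (u *m A) 0 (enum_rank_in Pi0 j).
  move=> Pj; rewrite big_enum_val mxE; apply: eq_bigr => i _.
  by rewrite /ext enum_valK_in mxE enum_rankK_in.
have uA : A \in unitmx.
  rewrite -row_free_unit; apply/inj_row_free => u u0; apply/rowP => i.
  have := inj (ext u) _ (enum_val i) (enum_valP i).
  rewrite /ext enum_valK_in mxE; apply => j Pj.
  by rewrite extE// u0 mxE.
exists (ext (\row_j (enum_val j == k)%:R *m invmx A)) => j Pj.
by rewrite extE// mulmxKV// mxE enum_rankK_in.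
Qed.

(** * Stability of the dual functions *)

Lemma Bernoulli_lt (R : realFieldType) (x : R) n :
  0 < x < 1 -> (2 <= n)%N -> 1 - n%:R * x < (1 - x) ^+ n.
Proof.
move=> /andP[x0 x1]; case: n => [|[|n]] // _.
elim: n => [|n IH]; first by rewrite expr2; nra.
rewrite exprS -natr1; have h : (1 - x) * (1 - n.+2%:R * x) < (1 - x) * (1 - x) ^+ n.+2.
  by rewrite ltr_pM2l// subr_gt0.
have n0 : 0 <= n.+2%:R :> R by [].
nra.
Qed.

Section Dual.
Variables (R : realType) (d : nat) (hd : (2 <= d)%N) (l : 'rV[R]_d) (H : R) (N : nat).
Hypotheses (H0 : 0 < H) (l0 : forall i, 0 < l 0 i) (lN : forall i, l 0 i <= N%:R * H).
Hypothesis lH : forall i, exists k : int, l 0 i = k%:~R * H.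
Variables (G : network R d) (R0 rho : R).
Hypothesis GO : forall x : node G, Omega l (val x).
Hypotheses (rho0 : 0 < rho) (HR : 4 * d%:R * R0 <= H).
Hypothesis mass_ge : forall (r : R) (x : 'rV[R]_d),
  R0 <= r -> Omega l x -> box l r x `<=` Omega l ->
  rho * (2 * r) ^+ d <= normM (box l r x) (@const_fun R d G 1) ^+ 2.
Local Notation Vhat := {ffun node G -> R}.
Local Notation one := (@const_fun R d G 1).
Local Notation pt := (@lattice_pt R d H N).
Implicit Types (x y z q p : 'rV[R]_d).

Let d0 : 0 < d%:R :> R. Proof. by rewrite ltr0n; case: (d) hd. Qed.

(** On the corner box at a vertex its nodal function is at least
    [m = (1 - 1 / (2 * d)) ^ d]; the others sum to at most [1 - m], and the
    difference of the two is this margin. *)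
Definition corner_margin : R := 2 * (1 - (2 * d%:R)^-1) ^+ d - 1.

(** The strict inequality is where the relative size [1 / (2 * d)] of a corner box
    is used: on it one nodal function outweighs all the others together. *)
Lemma corner_margin_gt0 : 0 < corner_margin.
Proof.
have dp := d0; have d2 : 2 <= d%:R :> R by rewrite ler_nat.
have x01 : 0 < (2 * d%:R : R)^-1 < 1.
  by rewrite invr_gt0 mulr_gt0//= invf_lt1 ?mulr_gt0//; lra.
have := Bernoulli_lt x01 hd; rewrite /corner_margin.
have -> : d%:R * (2 * d%:R)^-1 = 2^-1 :> R by field; rewrite gt_eqF.
lra.
Qed.

Lemma nodal_hat_corner y z (e : R) : 0 <= e <= 1 ->
  (forall i, `|z 0 i - y 0 i| <= e * H) -> (1 - e) ^+ d <= nodal_hat H y z.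
Proof.
move=> /andP[e0 e1] h; rewrite -[X in _ ^+ X]card_ord -prodr_const.
apply: ler_prod => i _; rewrite subr_ge0 e1/=.
have te : `|(z 0 i - y 0 i) / H| <= e.
  by rewrite normrM normfV (gtr0_norm H0) ler_pdivrMr.
by rewrite hat_in ?(le_trans te)// lerD2l lerN2.
Qed.

(** The corner box has side [H / (2 * d)]; its half side is at least [R0], which is
    what the homogeneity of the network requires. *)
Lemma corner_box x q : mesh_center l H x -> cbox (H / 2) x q -> exists Q,
  [/\ Q `<=` box l (H / 2) x,
      forall z, Q z -> forall i, `|z 0 i - q 0 i| <= (2 * d%:R)^-1 * H &
      Num.sqrt (rho * (H / (2 * d%:R)) ^+ d) <= normM Q one].
Proof.
move=> cx xq; have dp := d0; have Hp := H0.
have d2 : 2 <= d%:R :> R by rewrite ler_nat.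
pose e : R := (2 * d%:R)^-1; pose r := e * H / 2.
have e0 : 0 < e by rewrite invr_gt0 mulr_gt0.
have e1 : e <= 1 by rewrite invf_le1 ?mulr_gt0//; lra.
have r0 : 0 < r by rewrite !mulr_gt0.
pose p : 'rV[R]_d := q + e *: (x - q).
have pq i : `|p 0 i - q 0 i| <= r.
  rewrite !mxE addrAC subrr add0r normrM (gtr0_norm e0) distrC /r -mulrA.
  by rewrite ler_pM2l.
have px i : `|p 0 i - x 0 i| <= H / 2 - r.
  rewrite !mxE.
  have -> : q 0 i + e * (x 0 i - q 0 i) - x 0 i = (1 - e) * (q 0 i - x 0 i) by ring.
  rewrite normrM ger0_norm ?subr_ge0//.
  have -> : H / 2 - r = (1 - e) * (H / 2) by rewrite /r; ring.
  by rewrite ler_wpM2l ?subr_ge0.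
have sub : box l r p `<=` box l (H / 2) x.
  by apply: box_sub => i; have := px i; rewrite ler_norml => /andP[? ?]; split; lra.
have Op : Omega l p.
  by apply: (cbox_mesh_Omega H0 lH cx) => i; apply: le_trans (px i) _; lra.
exists (box l r p); split => //.
  move=> z /box_sub_cbox zp i; apply: le_trans (ler_distD (p 0 i) _ _) _.
  by have := zp i; have := pq i; rewrite /r -/e; lra.
have rR : R0 <= r.
  rewrite /r /e; have -> : (2 * d%:R)^-1 * H / 2 = H / (4 * d%:R).
    by field; rewrite gt_eqF.
  by rewrite ler_pdivlMr ?mulr_gt0// mulrC.
have := mass_ge rR Op (subset_trans sub (box_mesh_Omega H0 lH cx)).
have -> : 2 * r = H / (2 * d%:R) by rewrite /r /e; field; rewrite gt_eqF.
by move=> /ler_wsqrtr; rewrite sqrtr_sqr ger0_norm ?normM_ge0.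
Qed.

(** The smallest mass seminorm on an element of a multilinear function whose
    largest nodal value is one is at least this number, and the seminorms of the
    dual functions are at most its inverse. *)
Definition dual_bound : R :=
  corner_margin * Num.sqrt (rho * (H / (2 * d%:R)) ^+ d).

Lemma dual_bound_gt0 : 0 < dual_bound.
Proof.
rewrite mulr_gt0 ?corner_margin_gt0// sqrtr_gt0 mulr_gt0// exprn_gt0//.
by rewrite divr_gt0// mulr_gt0.
Qed.

Let vtx x : pred {ffun 'I_d -> 'I_N.+1} :=
  [pred a | pt a \in vertex l H (box l (H / 2) x)].

Let H2 : 0 < H / 2. Proof. by rewrite divr_gt0. Qed.

Let vtxP x a : vtx x a -> mesh_node l H (pt a) /\ cbox (H / 2) x (pt a).
Proof. by move=> /set_mem[na]; rewrite closure_box. Qed.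

(** At a vertex where the nodal values are largest, the corner box carries mass
    and the function there is dominated by that one nodal value. *)
Lemma coef_bound x (w : Vhat) (c : {ffun 'I_d -> 'I_N.+1} -> R) a0 :
  mesh_center l H x -> vtx x a0 -> (forall a, vtx x a -> `|c a| <= `|c a0|) ->
  (forall u : node G, box l (H / 2) x (val u) ->
     w u = \sum_(a | vtx x a) c a * nodal_hat H (pt a) (val u)) ->
  dual_bound * `|c a0| <= normM (box l (H / 2) x) w.
Proof.
move=> cx va0 cmax wE; have [na0 xa0] := vtxP va0.
have [Q [QT Qe Qm]] := corner_box cx xa0.
have m0 := corner_margin_gt0; have dp := d0.
apply: le_trans (normM_sub w QT).
apply: (@le_trans _ _ (corner_margin * `|c a0| * normM Q one)).
  rewrite /dual_bound mulrAC; apply: ler_wpM2l => //.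
  by rewrite mulr_ge0// ltW.
apply: normM_ge_const => [|u Qu]; first by rewrite mulr_ge0// ltW.
rewrite wE; last exact: QT.
rewrite (bigD1 a0)//=; set S := \sum_(a | _) _.
set h := nodal_hat H (pt a0) (val u).
have hge : (1 - (2 * d%:R)^-1) ^+ d <= h.
  apply: nodal_hat_corner (Qe _ Qu); rewrite invr_ge0 mulr_ge0//= ?ler0n//.
  rewrite invf_le1 ?mulr_gt0//.
  have : 2 <= d%:R :> R by rewrite ler_nat.
  lra.
have Sle : `|S| <= `|c a0| * (1 - h).
  apply: (le_trans (ler_norm_sum _ _ _)).
  apply: (@le_trans _ _ (`|c a0| * \sum_(a | a != a0) nodal_hat H (pt a) (val u))).
    rewrite mulr_sumr [leLHS]big_mkcond [leRHS]big_mkcond /=; apply: ler_sum => a _.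
    have hp := nodal_hat_ge0 H (pt a) (val u).
    case: ifPn => [/andP[va ->]|_]; last by case: ifP => // _; rewrite mulr_ge0.
    by rewrite normrM (ger0_norm hp) ler_wpM2r// cmax.
  apply: ler_wpM2l => //; have := sum_nodal_hat H0 lN (GO u).
  by rewrite (bigD1 a0)//= -/h; lra.
have := lerB_normD (c a0 * h) S; rewrite normrM (ger0_norm (nodal_hat_ge0 _ _ _)) -/h.
have := normr_ge0 (c a0); rewrite /corner_margin; nra.
Qed.

Lemma normM_span x (w : Vhat) (c : {ffun 'I_d -> 'I_N.+1} -> R) :
  w = \sum_(a | vtx x a) c a *: varphi G l H (pt a) ->
  normM (box l (H / 2) x) w ^+ 2 =
  \sum_(a | vtx x a) c a * ip (Mset (box l (H / 2) x) w) (varphi G l H (pt a)).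
Proof.
move=> wE; rewrite normM_sqr {2}wE ip_Mset_sumr; apply: eq_bigr => a _.
by rewrite ip_MsetZr.
Qed.

Lemma span_node x (w : Vhat) (c : {ffun 'I_d -> 'I_N.+1} -> R) :
  w = \sum_(a | vtx x a) c a *: varphi G l H (pt a) ->
  forall u : node G, w u = \sum_(a | vtx x a) c a * nodal_hat H (pt a) (val u).
Proof.
move=> -> u; rewrite sum_ffunE; apply: eq_bigr => a /vtxP[na _].
by rewrite !ffunE (lagrangeE H0 l0 lH na (GO u)).
Qed.

Lemma exists_max_coef x (c : {ffun 'I_d -> 'I_N.+1} -> R) a : vtx x a ->
  exists2 a0, vtx x a0 & forall b, vtx x b -> `|c b| <= `|c a0|.
Proof.
move=> va; case: (@arg_maxP _ _ _ a (vtx x) (fun b => `|c b|) va) => a0 va0 h.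
by exists a0.
Qed.

(** A combination in the kernel of the Gram matrix has zero mass, hence zero
    coefficients by the lower bound. *)
Lemma exists_dual x k : mesh_center l H x -> exists c,
  forall b, vtx x b -> ip (Mset (box l (H / 2) x)
     (\sum_(a | vtx x a) c a *: varphi G l H (pt a))) (varphi G l H (pt b)) = (b == k)%:R.
Proof.
move=> cx.
have sumE c b : ip (Mset (box l (H / 2) x)
     (\sum_(a | vtx x a) c a *: varphi G l H (pt a))) (varphi G l H (pt b)) =
   \sum_(a | vtx x a) c a * ip (Mset (box l (H / 2) x) (varphi G l H (pt a)))
     (varphi G l H (pt b)).
  rewrite ip_MsetC ip_Mset_sumr; apply: eq_bigr => a _.
  by rewrite ip_MsetZr ip_MsetC.
have [c cP|c cP] := @gram_solve R _ (vtx x)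
    (fun a b => ip (Mset (box l (H / 2) x) (varphi G l H (pt a))) (varphi G l H (pt b))) _ k.
  move=> a va; have [a0 va0 amax] := exists_max_coef c va.
  pose w : Vhat := \sum_(a | vtx x a) c a *: varphi G l H (pt a).
  have w0 : normM (box l (H / 2) x) w = 0.
    apply/eqP; rewrite -sqrf_eq0 (normM_span (erefl w)) big1// => b vb.
    by rewrite sumE cP// mulr0.
  have := coef_bound cx va0 amax (fun u _ => span_node (erefl w) u).
  rewrite w0 pmulr_rle0 ?dual_bound_gt0// normr_le0 => /eqP e.
  by have := amax _ va; rewrite e normr0 normr_le0 => /eqP.
by exists c => b vb; rewrite sumE cP.
Qed.

Lemma element_ofP y : mesh_node l H y -> exists x,
  [/\ mesh_center l H x, element_of l H y = box l (H / 2) x & cbox (H / 2) x y].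
Proof.
move=> ny; have [x cx xy] := mesh_cover H0 l0 lH ny.1.
have [[x' cx' <-] /box_sub_cbox x'y] :
    [set T | mesh l H T /\ T y] (element_of l H y).
  by apply: xgetPex; exists (box l (H / 2) x); split=> //; exists x.
by exists x'.
Qed.

Lemma varphi_out x z (u : node G) : mesh_center l H x -> mesh_node l H z ->
  box l (H / 2) x (val u) -> varphi G l H z u != 0 -> cbox (H / 2) x z.
Proof.
move=> cx nz xu; rewrite ffunE (lagrangeE H0 l0 lH nz (GO u)) => zu i.
have Hp := H0; have h1 := nodal_hat_supp H0 zu i; have h2 := box_sub_cbox xu i.
have := mesh_node_near H0 (n := 0) (i := i) cx nz; rewrite !add0r => h.
suff : `|z 0 i - x 0 i| <= 2^-1 * H by lra.
apply: h; apply: (le_lt_trans (ler_distD (val u 0 i) _ _)).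
by rewrite (distrC (z 0 i)); lra.
Qed.

(** The defining set of [psi] is inhabited: duality to the vertices of the element
    suffices because all the other nodal functions vanish on it. *)
Lemma psi_spec y : mesh_node l H y -> let T := element_of l H y in
  (exists c : 'rV[R]_d -> R,
     psi G l H y = \sum_(z \in vertex l H T) c z *: varphi G l H z) /\
  forall z, mesh_node l H z -> ip (Mset T (psi G l H y)) (varphi G l H z) = (z == y)%:R.
Proof.
move=> ny T; pose P := [set w : Vhat |
    (exists c : 'rV[R]_d -> R,
       w = \sum_(z \in vertex l H T) c z *: varphi G l H z) /\
    forall z, mesh_node l H z -> ip (Mset T w) (varphi G l H z) = (z == y)%:R].
suff : exists w, P w by apply: xgetPex.
have [x [cx]] := element_ofP ny; rewrite -/T => Tx xy.
have [k yk] := mesh_node_lattice H0 lN ny.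
have [c cP] := exists_dual k cx.
have inv : exists c' : 'rV[R]_d -> R, forall a, c' (pt a) = c a.
  exists (fun z => if [pick a | pt a == z] is Some a then c a else 0) => a.
  by case: pickP => [b /eqP/(lattice_pt_inj H0) ->//|/(_ a)]; rewrite eqxx.
have [c' c'E] := inv.
exists (\sum_(a | vtx x a) c a *: varphi G l H (pt a)); split.
  exists c'; rewrite (fsum_lattice H0 lN); last by move=> z [].
  by rewrite Tx; apply: eq_bigr => a _; rewrite c'E.
move=> z nz; have [b zb] := mesh_node_lattice H0 lN nz.
have [vb|vb] := boolP (vtx x b).
  by rewrite Tx zb cP// yk (inj_eq (lattice_pt_inj H0)).
rewrite Tx ip_MsetE big1 => [|u /set_mem xu]; last first.
  have [->|zu] := eqVneq (varphi G l H z u) 0; first by rewrite !mulr0.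
  case/negP: vb; apply/mem_set; split; rewrite -zb// closure_box//.
  exact: varphi_out cx nz xu zu.
case: eqP => // zy; case/negP: vb; apply/mem_set; split; rewrite -zb// closure_box//.
by rewrite zy.
Qed.

(** Testing the dual function against itself returns its own nodal value, which
    the previous bound controls in turn. *)
Lemma psi_bound y : mesh_node l H y ->
  dual_bound * normM (element_of l H y) (psi G l H y) <= 1.
Proof.
move=> ny; have [[c pE] pd] := psi_spec ny.
have [x [cx Tx xy]] := element_ofP ny; have [k yk] := mesh_node_lattice H0 lN ny.
rewrite Tx in pE pd *; set p := psi G l H y in pE pd *.
have {}pE : p = \sum_(a | vtx x a) c (pt a) *: varphi G l H (pt a).
  by rewrite pE (fsum_lattice H0 lN)// => z [].
have vk : vtx x k by apply/mem_set; split; rewrite -yk// closure_box.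
have nk : normM (box l (H / 2) x) p ^+ 2 = c y.
  rewrite (normM_span pE) (bigD1 k)//= -yk pd// eqxx mulr1 big1 ?addr0//.
  move=> a /andP[/vtxP[na _] ak]; rewrite pd// yk (inj_eq (lattice_pt_inj H0)).
  by rewrite (negbTE ak) mulr0.
have [a0 va0 amax] := exists_max_coef (c \o pt) vk.
have := coef_bound cx va0 amax (fun u _ => span_node pE u).
have := amax _ vk; rewrite /= -yk; have := ler_norm (c y); rewrite -nk.
have := dual_bound_gt0; have := normM_ge0 (box l (H / 2) x) p.
set m := normM _ p; set C := `|c (pt a0)|; move: (`|m ^+ 2|) => cy m0 b0 h1 h2 h3.
have [->|mn] := eqVneq m 0; first by rewrite mulr0 ler01.
have {}m0 : 0 < m by rewrite lt_def mn.
rewrite -(ler_pM2l m0) mulr1.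
apply: le_trans h3; rewrite mulrCA ler_pM2l// -expr2.
exact: le_trans h2.
Qed.

End Dual.

(** * Local approximation by a constant *)

Section Chain.
Variables (R : realType) (d : nat) (hd : (2 <= d)%N) (l : 'rV[R]_d) (H : R).
Hypotheses (H0 : 0 < H) (l0 : forall i, 0 < l 0 i).
Hypothesis lH : forall i, exists k : int, l 0 i = k%:~R * H.
Variables (G : network R d) (Gamma : set 'rV[R]_d) (R0 sigma rho mu : R).
Hypothesis GO : forall x : node G, Omega l (val x).
Hypotheses (R00 : 0 < R0) (rho0 : 0 < rho) (HR : 4 * d%:R * R0 <= H).
Hypothesis NA : network_assumptions G l Gamma R0 sigma rho.
Hypotheses (FR : friedrichs G l Gamma R0 mu) (PO : poincare G l R0 mu).
Local Notation Vhat := {ffun node G -> R}.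
Local Notation one := (@const_fun R d G 1).
Local Notation elt x := (box l (H / 2) x).
Implicit Types (x y z t s : 'rV[R]_d) (v : Vhat) (c B E : R).

Lemma scale_gap : 8 * R0 <= H.
Proof.
have h0 := R00; apply: le_trans HR; rewrite ler_pM2r//.
have : 2 <= d%:R :> R by rewrite ler_nat.
lra.
Qed.

Lemma homogeneity_ge (r : R) x : R0 <= r -> Omega l x -> box l r x `<=` Omega l ->
  rho * (2 * r) ^+ d <= normM (box l r x) one ^+ 2.
Proof.
move=> Rr Ox xO; have /andP[h _] := homogeneity NA Rr Ox xO.
have r0 : 0 < (2 * r) ^+ d by rewrite exprn_gt0// mulr_gt0// (lt_le_trans R00).
by move: h; rewrite mulrC ler_pdivlMr.
Qed.

Lemma homogeneity_le (r : R) x : R0 <= r -> Omega l x -> box l r x `<=` Omega l ->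
  normM (box l r x) one ^+ 2 <= sigma * (rho * (2 * r) ^+ d).
Proof.
move=> Rr Ox xO; have /andP[_ h] := homogeneity NA Rr Ox xO.
have r0 : 0 < (2 * r) ^+ d by rewrite exprn_gt0// mulr_gt0// (lt_le_trans R00).
by move: h; rewrite mulrC ler_pdivrMr// mulrA.
Qed.

Let H2R : R0 <= H / 2. Proof. have h1 := scale_gap; have h2 := R00; lra. Qed.

Lemma sigma_ge0 x : mesh_center l H x -> 0 <= sigma.
Proof.
move=> cx; have := homogeneity NA H2R cx.1 (box_mesh_Omega H0 lH cx).
move=> /andP[h1 h2]; have : 0 <= sigma * rho.
  by apply: ltW; apply: lt_le_trans rho0 (le_trans h1 h2).
by rewrite pmulr_lge0.
Qed.

Lemma normM_elt_one x : mesh_center l H x ->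
  normM (elt x) one ^+ 2 <= sigma * (rho * H ^+ d).
Proof.
move=> cx; have := homogeneity_le H2R cx.1 (box_mesh_Omega H0 lH cx).
by rewrite [2 * _]mulrC divfK.
Qed.

(** Constants approximating the same function on two sets are compared through
    the mass of a common subset. *)
Lemma const_dist (A B K : set 'rV[R]_d) v c c' : K `<=` A -> K `<=` B ->
  `|c - c'| * normM K one <= normM A (v - const_fun c) + normM B (v - const_fun c').
Proof.
move=> KA KB; rewrite -normM_const.
have -> : const_fun (c - c') = (v - const_fun c') - (v - const_fun c).
  by apply/ffunP => u; rewrite !ffunE; ring.
apply: le_trans (normM_triangleB _ _ _) _; rewrite addrC lerD ?normM_sub//.
Qed.

(** The halved side length costs [2 ^ d] in the mass, the inhomogeneity of the
    network costs [sigma]. *)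
Definition overlap_ratio : R := Num.sqrt (sigma * 2 ^+ d).

Lemma overlap_mass x y : mesh_center l H x -> mesh_center l H y ->
  (forall i, `|x 0 i - y 0 i| <= H) -> exists K,
  [/\ K `<=` elt x, K `<=` elt (2^-1 *: (x + y)) &
      forall z, mesh_center l H z -> normM (elt z) one <= overlap_ratio * normM K one].
Proof.
move=> cx cy xy; pose k : 'rV[R]_d := 4^-1 *: (3 *: x + y).
have hp := H0; have gap := scale_gap; have Rp := R00.
have R4 : R0 <= H / 4 by lra.
have KT : box l (H / 4) k `<=` elt x.
  by apply: box_sub => i; rewrite !mxE; have := xy i; rewrite ler_norml; lra.
exists (box l (H / 4) k); split => //.
  by apply: box_sub => i; rewrite !mxE; have := xy i; rewrite ler_norml; lra.
move=> z cz; have s0 := sigma_ge0 cx.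
have Ok : Omega l k.
  move=> i; rewrite !mxE; have := mesh_center_itv H0 lH i cx.
  by have := mesh_center_itv H0 lH i cy; lra.
have := homogeneity_ge R4 Ok (subset_trans KT (box_mesh_Omega H0 lH cx)).
have -> : 2 * (H / 4) = H / 2 by lra.
move=> Kge; rewrite -(ler_pXn2r (n := 2)) ?nnegrE ?mulr_ge0 ?normM_ge0 ?sqrtr_ge0//.
rewrite exprMn [overlap_ratio ^+ 2]sqr_sqrtr ?mulr_ge0 ?exprn_ge0//.
apply: le_trans (normM_elt_one cz) _.
have -> : sigma * (rho * H ^+ d) = sigma * 2 ^+ d * (rho * (H / 2) ^+ d).
  rewrite [in LHS](_ : H = 2 * (H / 2)); last by lra.
  by rewrite exprMn; ring.
by rewrite ler_wpM2l// mulr_ge0// exprn_ge0.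
Qed.

Lemma mu_bound (n m E : R) : m <= mu * (H / 2) * n -> 0 <= n -> n <= E ->
  m <= `|mu| * H * E.
Proof.
move=> h n0 nE; apply: le_trans h _; have hp := H0.
apply: (@le_trans _ _ (`|mu| * H * n)); last first.
  by rewrite ler_wpM2l// mulr_ge0// ltW.
rewrite ler_wpM2r//; have := ler_norm mu; have := normr_ge0 mu; nra.
Qed.

Lemma poincare_box s v E : Omega l s -> elt s `<=` Omega l ->
  normL (ebox l (H / 2 + R0) s) v <= E ->
  exists c, normM (elt s) (v - const_fun c) <= `|mu| * H * E.
Proof.
move=> Os sO sE; have [c h] := PO H2R Os sO v; exists c.
by apply: mu_bound h _ sE; exact: normL_ge0.
Qed.

(** The recursion for the bound, in units of [`|mu| * H] times the energy. *)
Definition chain_step B : R := 1 + 3 * overlap_ratio + overlap_ratio * B.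

(** The box halfway between two touching elements meets each of them in a
    box of half the side, so a single constant serves both elements. *)
Lemma adjacent_bound x y v c B E : mesh_center l H x -> mesh_center l H y ->
  (forall i, `|x 0 i - y 0 i| <= H) ->
  (forall s, (forall i, `|s 0 i - x 0 i| <= H / 2) ->
     normL (ebox l (H / 2 + R0) s) v <= E) ->
  normL (ebox l (H / 2 + R0) y) v <= E ->
  normM (elt x) (v - const_fun c) <= B * (`|mu| * H * E) ->
  normM (elt y) (v - const_fun c) <= chain_step B * (`|mu| * H * E).
Proof.
move=> cx cy xy sE yE xB; have hp := H0; pose s : 'rV[R]_d := 2^-1 *: (x + y).
have [K1 [K1x K1s K1m]] := overlap_mass cx cy xy.
have yx i : `|y 0 i - x 0 i| <= H by rewrite distrC.
have [K2 [K2y]] := overlap_mass cy cx yx; rewrite (addrC y) -/s => K2s K2m.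
rewrite -/s in K1s.
have scl : cbox (H / 2) s `<=` Omega l.
  move=> z zs i; have := zs i; rewrite !mxE ler_norml.
  have := mesh_center_itv H0 lH i cx.
  by have := mesh_center_itv H0 lH i cy; lra.
have Os : Omega l s by apply: scl => i; rewrite subrr normr0; lra.
have sO : elt s `<=` Omega l by apply: subset_trans scl; exact: box_sub_cbox.
have [|cs hs] := poincare_box Os sO (v := v) (E := E).
  by apply: sE => i; rewrite !mxE; have := xy i; rewrite !ler_norml; lra.
have [c' hy] := poincare_box cy.1 (box_mesh_Omega H0 lH cy) yE.
set b := `|mu| * H * E in xB hs hy *.
have d1 := const_dist v c cs K1x K1s; have d2 := const_dist v c' cs K2y K2s.
have -> : v - const_fun c = (v - const_fun c') + const_fun (c' - c).
  by apply/ffunP => u; rewrite !ffunE; ring.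
apply: le_trans (normM_triangle _ _ _) _; rewrite normM_const.
have t0 : 0 <= overlap_ratio by exact: sqrtr_ge0.
have h1 : `|c' - cs| * normM (elt y) one <= overlap_ratio * (b + b).
  apply: (@le_trans _ _ (`|c' - cs| * (overlap_ratio * normM K2 one))).
    by rewrite ler_wpM2l// K2m.
  by rewrite mulrCA ler_wpM2l// (le_trans d2)// lerD.
have h2 : `|cs - c| * normM (elt y) one <= overlap_ratio * (B * b + b).
  apply: (@le_trans _ _ (`|c - cs| * (overlap_ratio * normM K1 one))).
    by rewrite distrC ler_wpM2l// K1m.
  by rewrite mulrCA ler_wpM2l// (le_trans d1)// lerD.
have h3 : `|c' - c| * normM (elt y) one <=
    (`|c' - cs| + `|cs - c|) * normM (elt y) one.
  by rewrite ler_wpM2r ?normM_ge0// ler_distD.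
rewrite /chain_step; move: h3; rewrite mulrDl; lra.
Qed.

Section Patch.
Variables (t : 'rV[R]_d) (v : Vhat).
Hypothesis ct : mesh_center l H t.
Local Notation energy := (normL (patchn l H 3 (elt t)) v).

Lemma near_patch x : mesh_center l H x -> (forall i, `|x 0 i - t 0 i| <= 2 * H) ->
  elt x `<=` patchn l H 2 (elt t).
Proof.
move=> cx xt; have [z [cz zt xz]] := mesh_center_clamp H0 ct cx xt.
apply: (patch_adjacent H0 cz cx) => [i|]; first by rewrite distrC.
by apply: (patch_adjacent H0 ct cz) => // i; rewrite distrC.
Qed.

(** The enlargement by [R0] reaches only elements touching the one at [x], as
    [H / 2 + H / 2 + R0 + H / 2 < 2 * H]. *)
Lemma ebox_energy x s : mesh_center l H x -> (forall i, `|x 0 i - t 0 i| <= 2 * H) ->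
  (forall i, `|s 0 i - x 0 i| <= H / 2) ->
  normL (ebox l (H / 2 + R0) s) v <= energy.
Proof.
move=> cx xt sx; apply: normL_sub => z [/box_sub_cbox zs Oz].
have [y cy yz] := mesh_cover H0 l0 lH Oz.
have hp := H0; have gap := scale_gap; have Rp := R00.
apply: (patch_adjacent H0 cx cy (A := patchn l H 2 (elt t)) _ _ yz); last first.
  exact: near_patch.
move=> i; rewrite -[H]mul1r; apply: (mesh_center_near (n := 1) H0 cx cy).
have := box_sub_cbox yz i; have := zs i; have := sx i.
by rewrite !ler_norml ltr_norml => *; apply/andP; split; lra.
Qed.

Lemma chain_once x y c B : mesh_center l H x -> mesh_center l H y ->
  (forall i, `|x 0 i - t 0 i| <= 2 * H) -> (forall i, `|y 0 i - t 0 i| <= 2 * H) ->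
  (forall i, `|x 0 i - y 0 i| <= H) ->
  normM (elt x) (v - const_fun c) <= B * (`|mu| * H * energy) ->
  normM (elt y) (v - const_fun c) <= chain_step B * (`|mu| * H * energy).
Proof.
move=> cx cy xt yt xy; apply: adjacent_bound => // [s|]; first exact: ebox_energy.
by apply: ebox_energy cy yt _ => i; rewrite subrr normr0 divr_ge0// ltW.
Qed.

Definition chain_bound : R := iter 4 chain_step 1.

(** Any two of the elements at distance at most two from [t] are joined by a chain
    of four steps through [t]. *)
Lemma chain_all x y c : mesh_center l H x -> mesh_center l H y ->
  (forall i, `|x 0 i - t 0 i| <= 2 * H) -> (forall i, `|y 0 i - t 0 i| <= 2 * H) ->
  normM (elt x) (v - const_fun c) <= `|mu| * H * energy ->
  normM (elt y) (v - const_fun c) <= chain_bound * (`|mu| * H * energy).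
Proof.
move=> cx cy xt yt h; have hp := H0.
have [x' [cx' x't xx']] := mesh_center_clamp H0 ct cx xt.
have [y' [cy' y't yy']] := mesh_center_clamp H0 ct cy yt.
have le2 (z : 'rV[R]_d) : (forall i, `|z 0 i - t 0 i| <= H) ->
    forall i, `|z 0 i - t 0 i| <= 2 * H.
  by move=> zt i; apply: le_trans (zt i) _; lra.
have tt i : `|t 0 i - t 0 i| <= 2 * H by rewrite subrr normr0; lra.
apply: (chain_once cy' cy) => //; [exact: le2|by move=> i; rewrite distrC|].
apply: (chain_once ct cy') => //; [exact: le2|by move=> i; rewrite distrC|].
apply: (chain_once cx' ct) => //; [exact: le2|].
apply: (chain_once cx cx') => //; [exact: le2|].
by rewrite mul1r.
Qed.

Hypothesis VD : dirichlet Gamma v.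
Hypothesis GB : Gamma `<=` boundary (Omega l).
Hypothesis GF : union_of_mesh_faces l H Gamma.

(** A nodal function is nonzero on a mesh face only if its node lies on that
    face. *)
Lemma nonfree_node y : mesh_node l H y -> ~ free_node l H Gamma y -> Gamma y.
Proof.
move=> ny nfy; have hp := H0.
have [z Gz yz] : exists2 z, Gamma z & Defs.lagrange l H y z != 0.
  apply: contrapT => h; apply: nfy; split=> // z Gz.
  by apply/eqP; apply: contraT => yz; case: h; exists z.
have Oz : Omega l z by apply: closure_Omega; exact: (GB Gz).1.
rewrite (lagrangeE H0 l0 lH ny Oz) in yz; have {}yz := nodal_hat_supp H0 yz.
have [S SF GS] := GF; move: Gz; rewrite GS => -[F SFF Fz].
exists F => //; have [x [i [b [cx FE]]]] := SF _ SFF.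
have H20 : 0 < H / 2 by rewrite divr_gt0.
move: Fz; rewrite FE closure_box// => -[zx /= zi].
split=> [j|/=].
  have := mesh_node_near H0 (n := 0) (i := j) cx ny; rewrite !add0r => h.
  suff : `|y 0 j - x 0 j| <= 2^-1 * H by lra.
  apply: h; apply: (le_lt_trans (ler_distD (z 0 j) _ _)).
  by have := yz j; have := zx j; rewrite (distrC (y 0 j)); lra.
have [a ia ea] := mesh_center_int H0 i cx; have [a' ia' ea'] := mesh_node_int H0 i ny.
have [a'' ia'' ez] : exists2 a'', a'' \is a Num.int & z 0 i = a'' * H.
  rewrite zi ea; case: (b) => /=.
    by exists (a - 1); rewrite ?rpredB ?rpred1// expr1; lra.
  by exists a => //; rewrite expr0; lra.
have := yz i; rewrite ez ea' -mulrBl normrM (gtr0_norm H0) -ltr_pdivlMr// divff ?gt_eqF//.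
by move/(int_eq ia'' ia') => e; rewrite -zi ez e.
Qed.

(** If every nearby node is free, the interpolation reproduces constants and the
    constant may be taken from the Poincare inequality; otherwise a boundary node
    is near, and the constant has to be, and by the Friedrichs inequality can be,
    zero. *)
Lemma exists_const : exists2 c,
  c = 0 \/ (forall y, mesh_node l H y -> (forall i, `|y 0 i - t 0 i| <= 3 / 2 * H) ->
    free_node l H Gamma y) &
  forall y, mesh_center l H y -> (forall i, `|y 0 i - t 0 i| <= 2 * H) ->
    normM (elt y) (v - const_fun c) <= chain_bound * (`|mu| * H * energy).
Proof.
have hp := H0; have gap := scale_gap; have Rp := R00.
have tt i : `|t 0 i - t 0 i| <= 2 * H by rewrite subrr normr0; lra.
have tt2 i : `|t 0 i - t 0 i| <= H / 2 by rewrite subrr normr0; lra.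
have [allfree|] := pselect (forall y, mesh_node l H y ->
    (forall i, `|y 0 i - t 0 i| <= 3 / 2 * H) -> free_node l H Gamma y).
  have [c hc] := poincare_box ct.1 (box_mesh_Omega H0 lH ct) (ebox_energy ct tt tt2).
  exists c; first by right.
  by move=> y cy yt; exact: (chain_all ct cy).
move=> /existsNP[y /not_implyP[ny /not_implyP[yt /(nonfree_node ny) Gy]]].
have [u Gu uy] := boundary_density NA Gy.
have [x cx xu] := mesh_cover H0 l0 lH (GO u).
have xt i : `|x 0 i - t 0 i| <= 2 * H.
  apply: (mesh_center_near (n := 2) H0 cx ct).
  have : `|val u 0 i - y 0 i| <= Defs.edist (val u) y.
    rewrite -sqrtr_sqr ler_wsqrtr// (bigD1 i)//= lerDl sumr_ge0// => j _.
    exact: sqr_ge0.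
  have := box_sub_cbox xu i; have := yt i.
  rewrite !ler_norml ltr_norml => *; apply/andP; split; lra.
exists 0; first by left.
move=> z cz zt; apply: (chain_all cx cz) => //.
have -> : v - const_fun 0 = v by apply/ffunP => w; rewrite !ffunE subr0.
have x2 i : `|x 0 i - x 0 i| <= H / 2 by rewrite subrr normr0; lra.
have ex : exists w : node G, Gamma (val w) /\ elt x (val w) by exists u.
have h := FR H2R cx.1 (box_mesh_Omega H0 lH cx) ex VD.
by apply: mu_bound h _ (ebox_energy cx xt x2); exact: normL_ge0.
Qed.

End Patch.
End Chain.

(** * The interpolation operator *)

Section Interpolation.
Variables (R : realType) (d : nat) (hd : (2 <= d)%N) (l : 'rV[R]_d) (H : R) (N : nat).
Hypotheses (H0 : 0 < H) (l0 : forall i, 0 < l 0 i) (lN : forall i, l 0 i <= N%:R * H).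
Hypothesis lH : forall i, exists k : int, l 0 i = k%:~R * H.
Variables (G : network R d) (Gamma : set 'rV[R]_d) (R0 sigma rho : R).
Hypothesis GO : forall x : node G, Omega l (val x).
Hypotheses (R00 : 0 < R0) (rho0 : 0 < rho) (HR : 4 * d%:R * R0 <= H).
Hypothesis NA : network_assumptions G l Gamma R0 sigma rho.
Local Notation Vhat := {ffun node G -> R}.
Local Notation one := (@const_fun R d G 1).
Local Notation pt := (@lattice_pt R d H N).
Local Notation elt x := (box l (H / 2) x).
Local Notation free := (free_node l H Gamma).
Local Notation kappa := (dual_bound d H rho).
Implicit Types (x y z t : 'rV[R]_d) (v w : Vhat) (u : node G) (c E : R).

Let mass_ge := homogeneity_ge R00 NA.

Definition nodal_functional y v : R :=
  ip (Mset (element_of l H y) (psi G l H y)) v.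

(** The constant one is the sum of all the nodal functions, of which the functional
    sees exactly one. *)
Lemma nodal_functional_one y : mesh_node l H y -> nodal_functional y one = 1.
Proof.
move=> ny; have [_ pd] := psi_spec hd H0 l0 lN lH GO rho0 HR mass_ge ny.
have -> : one = \sum_(a | pt a \in mesh_node l H) varphi G l H (pt a).
  apply/ffunP => u; rewrite sum_ffunE ffunE -(sum_nodal_hat H0 lN (GO u)).
  rewrite [RHS]big_mkcond /=; apply: eq_bigr => a _; rewrite ffunE.
  case: ifPn => [/set_mem na|]; first by rewrite (lagrangeE H0 l0 lH na (GO u)).
  apply: contraNeq => /(nodal_hat_mesh_node H0 lH (GO u)).
  exact: mem_set.
rewrite /nodal_functional ip_Mset_sumr; have [k yk] := mesh_node_lattice H0 lN ny.
rewrite (bigD1 k) /=; last by rewrite -yk; exact: mem_set.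
rewrite pd -?yk// eqxx big1 ?addr0// => a /andP[/set_mem na ak].
by rewrite pd// yk (inj_eq (lattice_pt_inj H0)) (negbTE ak).
Qed.

Lemma nodal_functional_bound y w E : mesh_node l H y ->
  normM (element_of l H y) w <= E -> `|nodal_functional y w| <= E / kappa.
Proof.
move=> ny wE; have b0 := dual_bound_gt0 hd H0 rho0.
have := psi_bound hd H0 l0 lN lH GO rho0 HR mass_ge ny.
rewrite -ler_pdivlMl// mulr1 => pb.
apply: le_trans (normM_CauchySchwarz _ _ _) _; rewrite mulrC.
by apply: ler_pM => //; exact: normM_ge0.
Qed.

Lemma interpolant_node v u : interpolant l Gamma H v u =
  \sum_(a | pt a \in free) nodal_functional (pt a) v * nodal_hat H (pt a) (val u).
Proof.
rewrite /interpolant (fsum_lattice H0 lN); last by move=> y [].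
rewrite sum_ffunE; apply: eq_bigr => a /set_mem[na _].
by rewrite !ffunE (lagrangeE H0 l0 lH na (GO u)).
Qed.

Section Element.
Variables (t : 'rV[R]_d) (v : Vhat) (c E : R).
Hypothesis ct : mesh_center l H t.
Hypothesis cfree : c = 0 \/ (forall y, mesh_node l H y ->
  (forall i, `|y 0 i - t 0 i| <= 3 / 2 * H) -> free_node l H Gamma y).
Hypothesis vE : forall y, mesh_center l H y ->
  (forall i, `|y 0 i - t 0 i| <= 2 * H) -> normM (elt y) (v - const_fun c) <= E.
Local Notation J := (interpolant l Gamma H v - const_fun c).

Let near a := [forall i, `|pt a 0 i - t 0 i| <= 3 / 2 * H].

(** Coefficients are cut off away from [t], where no bound on the functionals is
    available. *)
Definition error_coef (a : {ffun 'I_d -> 'I_N.+1}) : R :=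
  if near a && (pt a \in free) then nodal_functional (pt a) (v - const_fun c) else 0.

Lemma E_ge0 : 0 <= E.
Proof.
have hp := H0; apply: le_trans (normM_ge0 (elt t) (v - const_fun c)) (vE ct _) => i.
by rewrite subrr normr0; lra.
Qed.

Lemma error_coef_bound a :
  `|error_coef a| <= E / kappa * [forall i, `|pt a 0 i - t 0 i| <= 3 / 2 * H]%:R.
Proof.
have E0 := E_ge0; have b0 := dual_bound_gt0 hd H0 rho0; have hp := H0.
rewrite /error_coef -/(near a); case: ifPn => [/andP[na /set_mem[ma _]]|_]; last first.
  by rewrite normr0 mulr_ge0// divr_ge0// ltW.
rewrite na mulr1; apply: nodal_functional_bound => //.
have [e [ce -> ea]] := element_ofP H0 l0 lH ma; apply: vE => // i.
apply: le_trans (ler_distD (pt a 0 i) _ _) _.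
have /forallP/(_ i) := na; have := ea i; rewrite (distrC (e 0 i)); lra.
Qed.

(** Both cases of the choice of the constant give the same expansion: either the
    constant is reproduced because all nearby nodal functions take part, or it is
    zero. *)
Lemma interpolant_error u : (forall i, `|val u 0 i - t 0 i| <= H / 2 + R0) ->
  J u = \sum_a error_coef a * nodal_hat H (pt a) (val u).
Proof.
move=> ut; have hp := H0; have gap := scale_gap hd R00 HR.
have -> : J u = interpolant l Gamma H v u - c by rewrite !ffunE.
rewrite interpolant_node -[- c]mulr1 -(sum_nodal_hat H0 lN (GO u)) mulr_sumr.
rewrite big_mkcond -big_split /=.
apply: eq_bigr => a _.
have [->|au] := eqVneq (nodal_hat H (pt a) (val u)) 0.
  by rewrite !mulr0 addr0; case: ifP.
have ma := nodal_hat_mesh_node H0 lH (GO u) au.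
have na : near a.
  apply/forallP => i; have := mesh_node_near H0 (n := 1) (i := i) ct ma.
  have -> : 1 + 2^-1 = 3 / 2 :> R by field.
  apply; apply: le_lt_trans (ler_distD (val u 0 i) _ _) _.
  have := nodal_hat_supp H0 au i; have := ut i; rewrite (distrC (pt a 0 i)); lra.
have lin : nodal_functional (pt a) (v - const_fun c) = nodal_functional (pt a) v - c.
  have -> : v - const_fun c = v + (- c) *: one.
    by apply/ffunP => x; rewrite !ffunE /GRing.scale /= mulr1.
  rewrite /nodal_functional ip_MsetDr ip_MsetZr -/(nodal_functional _ one).
  by rewrite nodal_functional_one// mulr1.
rewrite /error_coef na /= lin; case: cfree => [->|allfree].
  by case: ifP; rewrite !(oppr0, mul0r, addr0, subr0).
rewrite mem_set; first by rewrite mulrDl.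
by apply: allfree => // i; have /forallP := na.
Qed.

Lemma interpolant_error_le u : (forall i, `|val u 0 i - t 0 i| <= H / 2 + R0) ->
  `|J u| <= E / kappa.
Proof.
move=> ut; rewrite interpolant_error//; have E0 := E_ge0.
have b0 := dual_bound_gt0 hd H0 rho0.
apply: le_trans (ler_norm_sum _ _ _) _; rewrite -[leRHS]mulr1.
rewrite -(sum_nodal_hat H0 lN (GO u)) mulr_sumr ler_sum// => a _.
rewrite normrM (ger0_norm (nodal_hat_ge0 _ _ _)) ler_wpM2r ?nodal_hat_ge0//.
apply: le_trans (error_coef_bound a) _.
by rewrite ler_piMr ?lern1 ?leq_b1// divr_ge0// ltW.
Qed.

(** At most [6 ^ d] nodal functions are involved; [d] bounds the sum of the
    coordinate differences by the Euclidean distance. *)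
Definition lipschitz_factor : R := 6 ^+ d * d%:R.

Lemma interpolant_error_lipschitz u u' :
  (forall i, `|val u 0 i - t 0 i| <= H / 2 + R0) ->
  (forall i, `|val u' 0 i - t 0 i| <= H / 2 + R0) ->
  `|J u - J u'| <= E / kappa * lipschitz_factor / H * elen u u'.
Proof.
move=> ut ut'; rewrite !interpolant_error//; have E0 := E_ge0.
have b0 := dual_bound_gt0 hd H0 rho0.
have Eb : 0 <= E / kappa by rewrite divr_ge0// ltW.
rewrite -sumrB; apply: le_trans (ler_norm_sum _ _ _) _.
have D a : `|nodal_hat H (pt a) (val u) - nodal_hat H (pt a) (val u')| <=
    H^-1 * (d%:R * elen u u').
  apply: le_trans (nodal_hat_lipschitz H0 _ _ _) _.
  rewrite ler_pM2l ?invr_gt0//.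
  apply: (@le_trans _ _ (\sum_(i < d) elen u u')); last first.
    by rewrite sumr_const card_ord mulr_natl.
  apply: ler_sum => i _; rewrite /elen /Defs.edist -sqrtr_sqr ler_wsqrtr//.
  by rewrite (bigD1 i)//= lerDl sumr_ge0// => j _; exact: sqr_ge0.
apply: (@le_trans _ _ (\sum_a E / kappa *
    [forall i, `|pt a 0 i - t 0 i| <= 3 / 2 * H]%:R * (H^-1 * (d%:R * elen u u')))).
  apply: ler_sum => a _; rewrite -mulrBr normrM; apply: ler_pM => //.
  exact: error_coef_bound.
rewrite -mulr_suml -mulr_sumr.
have -> : E / kappa * lipschitz_factor / H * elen u u' =
    E / kappa * 6 ^+ d * (H^-1 * (d%:R * elen u u')).
  by rewrite /lipschitz_factor; ring.
apply: ler_wpM2r.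
  by rewrite !mulr_ge0 ?invr_ge0 ?(ltW H0)// ?ler0n//; exact: elen_ge0.
by apply: ler_wpM2l => //; exact: count_lattice_near.
Qed.

(** The mass of an element against that of a corner box, divided by the margin. *)
Definition stability_factor : R := Num.sqrt (sigma * (2 * d%:R) ^+ d) / corner_margin R d.

Lemma dual_mass : kappa^-1 * normM (elt t) one <= stability_factor.
Proof.
have b0 := dual_bound_gt0 hd H0 rho0; have m0 := corner_margin_gt0 R hd.
have d0 : 0 < d%:R :> R by rewrite ltr0n; case: (d) hd.
have s0 : 0 <= sigma := sigma_ge0 hd H0 lH R00 rho0 HR NA ct.
rewrite mulrC ler_pdivrMr// /stability_factor /dual_bound mulrA divfK ?gt_eqF//.
rewrite -(ler_pXn2r (n := 2)) ?nnegrE ?mulr_ge0 ?normM_ge0 ?sqrtr_ge0//.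
have q0 : 0 < (H / (2 * d%:R)) ^+ d by rewrite exprn_gt0// divr_gt0// mulr_gt0.
have q1 : 0 < (2 * d%:R : R) ^+ d by rewrite exprn_gt0// mulr_gt0.
rewrite exprMn ![in leRHS]sqr_sqrtr ?(mulr_ge0 s0 (ltW q1)) ?(ltW (mulr_gt0 rho0 q0))//.
apply: le_trans (normM_elt_one hd H0 lH R00 HR NA ct) _.
rewrite [in leLHS](_ : H = (2 * d%:R) * (H / (2 * d%:R))); last first.
  by field; rewrite gt_eqF.
by rewrite exprMn le_eqVlt; apply/orP; left; apply/eqP; ring.
Qed.

Lemma element_estimate :
  H^-1 * normM (elt t) (v - interpolant l Gamma H v)
    + normL (elt t) (interpolant l Gamma H v)
  <= (1 + stability_factor + stability_factor * lipschitz_factor) * (H^-1 * E).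
Proof.
have E0 := E_ge0; have b0 := dual_bound_gt0 hd H0 rho0; have hp := H0.
have Eb : 0 <= E / kappa by rewrite divr_ge0// ltW.
have gap := scale_gap hd R00 HR; have Rp := R00.
have near_t u : elt t (val u) -> forall i, `|val u 0 i - t 0 i| <= H / 2 + R0.
  by move=> /box_sub_cbox ut i; apply: le_trans (ut i) _; lra.
have massE : E / kappa * normM (elt t) one <= E * stability_factor.
  by rewrite -mulrA ler_wpM2l// dual_mass.
have MJ : normM (elt t) J <= E * stability_factor.
  apply: le_trans massE; apply: normM_le_const => // u ut.
  by apply: interpolant_error_le; exact: near_t.
have Mv : normM (elt t) (v - interpolant l Gamma H v) <= E + E * stability_factor.
  have -> : v - interpolant l Gamma H v = (v - const_fun c) - J.
    by apply/ffunP => u; rewrite !ffunE; ring.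
  apply: le_trans (normM_triangleB _ _ _) _; rewrite lerD// vE// => i.
  by rewrite subrr normr0; lra.
have lf0 : 0 <= lipschitz_factor by rewrite mulr_ge0 ?exprn_ge0 ?ler0n.
have LI : normL (elt t) (interpolant l Gamma H v) <=
    H^-1 * (E * stability_factor * lipschitz_factor).
  apply: (@le_trans _ _ (E / kappa * lipschitz_factor / H * normM (elt t) one)).
    apply: normL_lipschitz => [|u u' ut uu'].
      by apply: divr_ge0; [exact: mulr_ge0|exact: ltW].
    have -> : interpolant l Gamma H v u - interpolant l Gamma H v u' = J u - J u'.
      by rewrite !ffunE; ring.
    apply: interpolant_error_lipschitz => [|i]; first exact: near_t.
    apply: (le_trans (ler_distD (val u 0 i) _ _)).
    have := box_sub_cbox ut i.
    have : `|val u' 0 i - val u 0 i| <= elen u u'.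
      rewrite distrC -sqrtr_sqr ler_wsqrtr// (bigD1 i)//= lerDl sumr_ge0// => j _.
      exact: sqr_ge0.
    by have := locality NA uu'; lra.
  have -> : E / kappa * lipschitz_factor / H * normM (elt t) one =
      H^-1 * (E / kappa * normM (elt t) one * lipschitz_factor) by ring.
  by rewrite ler_pM2l ?invr_gt0// ler_wpM2r.
have -> : (1 + stability_factor + stability_factor * lipschitz_factor) * (H^-1 * E) =
    H^-1 * (E + E * stability_factor) + H^-1 * (E * stability_factor * lipschitz_factor).
  by ring.
by rewrite lerD// ler_pM2l ?invr_gt0.
Qed.

End Element.
End Interpolation.

Theorem lemma3p5 (R : realType) (d : nat) (mu sigma : R) (hd : (2 <= d)%N) :
  exists C : R,
  forall (l : 'rV[R]_d) (G : network R d) (Gamma : set 'rV[R]_d)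
         (R0 rho H : R),
    (forall i, 0 < l 0 i) ->
    (forall x : node G, Omega l (val x)) ->
    connected_network G ->
    Gamma `<=` boundary (Omega l) ->
    0 < R0 -> 0 < rho ->
    network_assumptions G l Gamma R0 sigma rho ->
    friedrichs G l Gamma R0 mu ->
    poincare G l R0 mu ->
    (forall i, exists k : int, l 0 i = k%:~R * H) ->
    union_of_mesh_faces l H Gamma ->
    free_node l H Gamma `<` mesh_node l H ->
    4 * d%:R * R0 <= H ->
    forall v : {ffun node G -> R}, dirichlet Gamma v ->
    forall T : set 'rV[R]_d, mesh l H T ->
      H^-1 * normM T (v - interpolant l Gamma H v)
        + normL T (interpolant l Gamma H v)
      <= C * normL (patchn l H 3 T) v.
Proof.
exists ((1 + stability_factor d sigma + stability_factor d sigma * lipschitz_factor R d)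
  * chain_bound d sigma * `|mu|).
move=> l G Gamma R0 rho H l0 GO _ GB R00 rho0 NA FR PO lH GF _ HR v VD _ [t ct <-].
have H0 : 0 < H.
  by apply: lt_le_trans HR; rewrite !mulr_gt0// ltr0n; case: (d) hd.
have [N lN] : exists N : nat, forall i, l 0 i <= N%:R * H.
  have /choice[k kE] := lH; exists (\max_i `|k i|)%N => i; rewrite kE ler_pM2r//.
  apply: (@le_trans _ _ (`|k i|%N%:R)).
    by rewrite natr_absz ler_int ler_norm.
  by rewrite ler_nat (leq_bigmax (F := fun i => `|k i|%N)).
have [c cfree cE] := exists_const hd H0 l0 lH GO R00 rho0 HR NA FR PO ct VD GB GF.
apply: le_trans (element_estimate hd H0 l0 lN lH GO R00 rho0 HR NA ct cfree cE) _.
rewrite le_eqVlt; apply/orP; left; apply/eqP.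
by field; rewrite gt_eqF.
Qed.
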